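(* Let $\aleph$ be an infinite cardinal, $\mathbb K$ a field, $I$ a nonempty $\aleph$-poset having a finite cofinal subset, and $J$ an upper subset of $I$. Then: (1) $H(I,J)$ is prime if and only if $J$ is downward directed; (2) $H(I,J)$ is right primitive if and only if $J$ has a coinitial chain, if and only if $H(I,J)$ is left primitive.
   Context: An upper subset $J$ of $I$ is one such that $j\in J$, $k\in I$, $j\le k$ imply $k\in J$. A poset $J$ is downward directed if it is nonempty and any two elements of $J$ have a common lower bound in $J$; a coinitial chain of $J$ is a nonempty totally ordered subset $C\subseteq J$ such that for every $j\in J$ there is $c\in C$ with $c\le j$. A ring is right (left) primitive if it has a faithful simple right (left) module; prime and primitive rings are understood to be nonzero. For $J$ an upper subset of $I$ the ring $H(I,J)$ defined below has a multiplicative identity. Conventions. $\aleph$ is an infinite cardinal, regarded as an initial ordinal, so that $\emptyset\in\aleph$; $\mathbb K$ is a field. For a poset $P$, $\mathcal M(P)$ is the set of all maximal chains of $P$ (maximal totally ordered subsets). An $\aleph$-poset is a partially ordered set $I$ with $|I|\le\aleph$ and $|\mathcal M(I)|\le\aleph$. For $i\in I$: $\{i\le\}=\{k\in I: i\le k\}$, $\{\le i\}=\{k\in I:k\le i\}$, $\{i\not\le\}=I\setminus\{i\le\}$, with the induced orders. For a set $A$, $\aleph^{(A)}$ is the set of maps $p:A\to\aleph$ with $p(a)=\emptyset$ for all but finitely many $a\in A$. For a set $X$, $\mathrm{CFM}_X(\mathbb K)$ is the $\mathbb K$-algebra of column-finite $X\times X$ matrices over $\mathbb K$, and $\mathrm{FR}_X(\mathbb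 K)$ is its ideal of matrices with only finitely many nonzero rows; $a(x,y)$ denotes the entry of $a$ in row $x$, column $y$. Construction. Let $X(I)=\aleph^{(I)}\times\mathcal M(I)$ and $Q(I)=\mathrm{CFM}_{X(I)}(\mathbb K)$. For $i\in I$ let $X(i\le)=\aleph^{(\{i\le\})}\times\mathcal M(\{i\le\})$ and let $\psi_{I,i}:\mathrm{CFM}_{X(i\le)}(\mathbb K)\to Q(I)$ be the injective (not necessarily unital) $\mathbb K$-algebra homomorphism given, for $p,q\in\aleph^{(I)}$ and $A,B\in\mathcal M(I)$, by $$\psi_{I,i}(a)((p,A),(q,B))=a\big((p|_{\{i\le\}},A\cap\{i\le\}),(q|_{\{i\le\}},B\cap\{i\le\})\big)$$ if $i\in A\cap B$, $A\cap\{\le i\}=B\cap\{\le i\}$ and $p|_{\{i\not\le\}}=q|_{\{i\not\le\}}$, and $\psi_{I,i}(a)((p,A),(q,B))=0$ otherwise. Put $H(I,i)=\psi_{I,i}(\mathrm{FR}_{X(i\le)}(\mathbb K))$ if $i$ is not a maximal element of $I$, and $H(I,i)=\mathbb K\,\psi_{I,i}(\mathbf 1)$ if $i$ is a maximal element of $I$. For $J\subseteq I$ put $H(I,J)=\sum_{j\in J}H(I,j)\subseteq Q(I)$; this sum is direct and $H(I,J)$ is a (not necessarily unital) $\mathbb K$-subalgebra of $Q(I)$. *)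

(* Defs.v *)
From HB Require Import structures.
From mathcomp Require Import all_boot all_order all_algebra.
From mathcomp Require Import finmap mathcomp_extra boolp classical_sets.
From mathcomp Require Import functions cardinality fsbigop.

Set Implicit Arguments.
Unset Strict Implicit.
Unset Printing Implicit Defensive.

Import Order.TTheory GRing.Theory.
Local Open Scope classical_set_scope.
Local Open Scope ring_scope.

(* The bottom element of [o] is the empty ordinal. *)
Definition infinite_initial_ordinal (d : Order.disp_t) (o : bOrderType d) :=
  [/\ infinite_set [set: o],
      well_founded (fun a b : o => (a < b)%O)
    & forall a : o, ~ ([set: o] #<= [set b | (b < a)%O])%card].

Section Posets.
Context {d : Order.disp_t} (P : porderType d).

Definition maximal_chain (A : set P) :=
  total_on A <=%O /\
  forall B : set P, total_on B <=%O -> A `<=` B -> B = A.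

Definition maximal_element (i : P) := forall k, (i <= k)%O -> k = i.

Definition upper_subset (J : set P) :=
  forall j k, J j -> (j <= k)%O -> J k.

Definition has_finite_cofinal :=
  exists2 F : set P, finite_set F & forall i, exists2 f, F f & (i <= f)%O.

Definition downward_directed (J : set P) :=
  J !=set0 /\
  forall x y, J x -> J y -> exists z, [/\ J z, (z <= x)%O & (z <= y)%O].

Definition has_coinitial_chain (J : set P) :=
  exists C : set P, [/\ C !=set0, C `<=` J, total_on C <=%O
    & forall j, J j -> exists2 c, C c & (c <= j)%O].

Record mchain := MChain {
  mchain_set :> set P;
  mchainP : maximal_chain mchain_set }.
HB.instance Definition _ := gen_eqMixin mchain.
HB.instance Definition _ := gen_choiceMixin mchain.

Record up (i : P) := Up { up_val :> P; upP : (i <= up_val)%O }.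
HB.instance Definition _ i := [isSub for @up_val i].
HB.instance Definition _ i := [Choice of up i by <:].
HB.instance Definition _ i := [SubChoice_isSubPOrder of up i by <: with d].

Lemma mchain_inj (A B : mchain) : (A : set P) = B -> A = B.
Proof.
by case: A B => [A hA] [B hB] /= e; subst B; rewrite (Prop_irrelevance hA hB).
Qed.

End Posets.

Section FinSupp.
Context {da : Order.disp_t} (aleph : bOrderType da).

Record finsupp (T : Type) := FinSupp {
  finsupp_fun :> T -> aleph;
  finsuppP : finite_set [set t | finsupp_fun t != \bot%O] }.
HB.instance Definition _ T := gen_eqMixin (finsupp T).
HB.instance Definition _ T := gen_choiceMixin (finsupp T).

Lemma finsupp_inj T (p q : finsupp T) : p =1 q -> p = q.
Proof.
case: p q => [p hp] [q hq] /= /funext e; subst q.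
by rewrite (Prop_irrelevance hp hq).
Qed.

End FinSupp.

Definition aleph_poset (da : Order.disp_t) (aleph : bOrderType da)
    (d : Order.disp_t) (P : porderType d) :=
  ([set: P] #<= [set: aleph])%card /\
  ([set A : set P | maximal_chain A] #<= [set: aleph])%card.

Section CFM.
Context (K : fieldType) (X : choiceType).

Definition column_finite : {pred X -> X -> K} :=
  fun a => `[< forall y, finite_set [set x | a x y != 0] >].

Record cfm := CFM { entry :> X -> X -> K; _ : column_finite entry }.
HB.instance Definition _ := [isSub for entry].
HB.instance Definition _ := [Choice of cfm by <:].

Lemma column_finite_zmod_closed : zmod_closed column_finite.
Proof.
split.
  apply/asboolP => y; apply: (@sub_finite_set _ _ set0) => // x /=.
  by rewrite eqxx.
move=> a b /asboolP ha /asboolP hb; apply/asboolP => y.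
apply: (@sub_finite_set _ _ ([set x | a x y != 0] `|` [set x | b x y != 0])).
  move=> x /= h; apply/orP; rewrite -negb_and; apply: contraNN h.
  move=> /andP[/eqP e1 /eqP e2].
  have -> : (a - b) x y = a x y - b x y by [].
  by rewrite e1 e2 subr0.
by rewrite finite_setU.
Qed.
HB.instance Definition _ := GRing.isZmodClosed.Build (X -> X -> K)
  column_finite column_finite_zmod_closed.
HB.instance Definition _ := [SubChoice_isSubZmodule of cfm by <:].

Lemma cfmP (a b : cfm) : (forall x y, a x y = b x y) -> a = b.
Proof. by move=> h; apply/val_inj/funext => x; apply/funext => y; exact: h. Qed.

Lemma cfm_colP (a : cfm) y : finite_set [set x | a x y != 0].
Proof. by have /asboolP := valP a; exact. Qed.

Lemma cfm_colE (a : cfm) z :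
  exists2 s : seq X, uniq s & forall y, y \notin s -> a y z = 0.
Proof.
exists (fset_set [set x | a x z != 0]) => // y.
rewrite in_fset_set; last exact: cfm_colP.
by move=> /negP h; apply/eqP/negPn/negP => h'; apply: h; rewrite inE.
Qed.

Lemma fsum_seq (s : seq X) (F : X -> K) : uniq s ->
  (forall y, y \notin s -> F y = 0) ->
  \sum_(y \in [set: X]) F y = \sum_(y <- s) F y.
Proof.
move=> us h; rewrite (fsbigE s) //; last by move=> i _; exact: h.
by apply: eq_bigl => i; rewrite in_setT.
Qed.

Lemma cfm_scale_subproof (c : K) (a : cfm) :
  column_finite (fun x y => c * a x y).
Proof.
apply/asboolP => y; apply: sub_finite_set (cfm_colP a y) => x /=.
by rewrite mulf_eq0 negb_or => /andP[].
Qed.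
Definition cfm_scale c a := CFM (cfm_scale_subproof c a).

Lemma cfm_scaleA c c' a : cfm_scale c (cfm_scale c' a) = cfm_scale (c * c') a.
Proof. by apply: cfmP => x y /=; rewrite mulrA. Qed.
Lemma cfm_scale1 : left_id 1 cfm_scale.
Proof. by move=> a; apply: cfmP => x y /=; rewrite mul1r. Qed.
Lemma cfm_scaleDr : right_distributive cfm_scale +%R.
Proof. by move=> c a b; apply: cfmP => x y; exact: mulrDr. Qed.
Lemma cfm_scaleDl a : {morph cfm_scale^~ a : c c' / c + c'}.
Proof. by move=> c c'; apply: cfmP => x y; exact: mulrDl. Qed.
HB.instance Definition _ := GRing.Zmodule_isLmodule.Build K cfm
  cfm_scaleA cfm_scale1 cfm_scaleDr cfm_scaleDl.

Lemma cfmD (a b : cfm) x y : (a + b) x y = a x y + b x y. Proof. by []. Qed.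
Lemma cfmN (a : cfm) x y : (- a) x y = - a x y. Proof. by []. Qed.
Lemma cfmZ c (a : cfm) x y : (c *: a) x y = c * a x y. Proof. by []. Qed.
Lemma cfm0 x y : (0 : cfm) x y = 0. Proof. by []. Qed.

(* Each sum has finite support, the columns of [b] being finite. *)
Definition cfm_mul_fun (a b : cfm) x z := \sum_(y \in [set: X]) a x y * b y z.

Lemma cfm_mul_seq (a b : cfm) x z s : uniq s ->
  (forall y, y \notin s -> b y z = 0) ->
  cfm_mul_fun a b x z = \sum_(y <- s) a x y * b y z.
Proof. by move=> us h; apply: fsum_seq => // y /h ->; rewrite mulr0. Qed.

Lemma cfm_mul_neq0 (a b : cfm) x z : cfm_mul_fun a b x z != 0 ->
  exists y, a x y != 0 /\ b y z != 0.
Proof.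
move=> h; apply: contrapT => /forallNP h'; move/negP: h; apply; apply/eqP.
apply: fsbig1 => y _; apply/eqP; apply: contrapT => /negP.
by rewrite mulf_eq0 negb_or => /andP[? ?]; exact: (h' y).
Qed.

Lemma cfm_mul_subproof a b : column_finite (cfm_mul_fun a b).
Proof.
apply/asboolP => z.
apply: (@sub_finite_set _ _
  (\bigcup_(y in [set y | b y z != 0]) [set x | a x y != 0])).
  by move=> x /= /cfm_mul_neq0[y [h1 h2]]; exists y.
by apply: bigcup_finite => [|y _]; exact: cfm_colP.
Qed.
Definition cfm_mul a b := CFM (cfm_mul_subproof a b).

Lemma cfm_one_subproof : column_finite (fun x y => (x == y)%:R).
Proof.
apply/asboolP => y; apply: (@sub_finite_set _ _ [set y]) => // x /=.
by case: (eqVneq x y) => [->|_] /=; rewrite ?eqxx.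
Qed.
Definition cfm_one := CFM cfm_one_subproof.

Lemma cfm_mulA : associative cfm_mul.
Proof.
move=> a b c; apply: cfmP => x z /=.
have [s us hs] := cfm_colE c z.
have [f hf] : exists f : X -> seq X,
    forall w, uniq (f w) /\ forall y, y \notin f w -> b y w = 0.
  exists (fun w => s2val (cid2 (cfm_colE b w))) => w.
  by split; [exact: (s2valP (cid2 (cfm_colE b w)))
            | exact: (s2valP' (cid2 (cfm_colE b w)))].
pose t := undup (flatten [seq f w | w <- s]).
have ht w y : w \in s -> y \notin t -> b y w = 0.
  move=> ws; rewrite mem_undup => yt; apply: (hf w).2.
  apply: contraNN yt => yf; apply/flattenP; exists (f w) => //.
  by apply/mapP; exists w.
have bc y : cfm_mul_fun b c y z = \sum_(w <- s) b y w * c w z.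
  exact: cfm_mul_seq.
rewrite (@cfm_mul_seq _ _ _ _ t) ?undup_uniq //; last first.
  move=> y yt; rewrite /= bc big_seq big1 // => w ws.
  by rewrite (ht w y ws yt) mul0r.
rewrite (@cfm_mul_seq _ _ _ _ _ us) //.
transitivity (\sum_(w <- s) \sum_(y <- t) a x y * b y w * c w z).
  rewrite exchange_big /=; apply: eq_bigr => y _; rewrite bc mulr_sumr.
  by apply: eq_bigr => w _; rewrite mulrA.
rewrite big_seq [RHS]big_seq; apply: eq_bigr => w ws /=.
rewrite (@cfm_mul_seq _ _ _ _ t) ?undup_uniq //; last by move=> y; exact: ht.
by rewrite mulr_suml.
Qed.

Lemma cfm_mul1 : left_id cfm_one cfm_mul.
Proof.
move=> a; apply: cfmP => x z /=; rewrite /cfm_mul_fun (@fsum_seq [:: x]) //.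
  by rewrite big_seq1 /= eqxx mul1r.
by move=> y; rewrite inE eq_sym => /negbTE /= ->; rewrite mul0r.
Qed.

Lemma cfm_mulr1 : right_id cfm_one cfm_mul.
Proof.
move=> a; apply: cfmP => x z /=; rewrite /cfm_mul_fun (@fsum_seq [:: z]) //.
  by rewrite big_seq1 /= eqxx mulr1.
by move=> y; rewrite inE => /negbTE /= ->; rewrite mulr0.
Qed.

Lemma cfm_mulDl : left_distributive cfm_mul +%R.
Proof.
move=> a b c; apply: cfmP => x z; have [s us hs] := cfm_colE c z.
change (cfm_mul_fun (a + b) c x z = cfm_mul_fun a c x z + cfm_mul_fun b c x z).
rewrite !(@cfm_mul_seq _ _ _ _ _ us) // -big_split.
by apply: eq_bigr => y _; exact: mulrDl.
Qed.

Lemma cfm_mulDr : right_distributive cfm_mul +%R.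
Proof.
move=> a b c; apply: cfmP => x z.
have [s us hs] := cfm_colE b z; have [t ut ht] := cfm_colE c z.
have hb y : y \notin undup (s ++ t) -> b y z = 0.
  by rewrite mem_undup mem_cat negb_or => /andP[/hs].
have hc y : y \notin undup (s ++ t) -> c y z = 0.
  by rewrite mem_undup mem_cat negb_or => /andP[_ /ht].
have u := undup_uniq (s ++ t).
change (cfm_mul_fun a (b + c) x z = cfm_mul_fun a b x z + cfm_mul_fun a c x z).
rewrite !(@cfm_mul_seq _ _ _ _ _ u) //; last first.
  by move=> y h; rewrite cfmD hb // hc // addr0.
by rewrite -big_split; apply: eq_bigr => y _; exact: mulrDr.
Qed.

HB.instance Definition _ := GRing.Zmodule_isPzRing.Build cfm
  cfm_mulA cfm_mul1 cfm_mulr1 cfm_mulDl cfm_mulDr.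

Lemma cfmM (a b : cfm) x z :
  (a * b) x z = \sum_(y \in [set: X]) a x y * b y z.
Proof. by []. Qed.

Lemma cfm1 x y : (1 : cfm) x y = (x == y)%:R. Proof. by []. Qed.

Definition finite_rows : set cfm :=
  [set a | finite_set [set x | exists y, a x y != 0]].

End CFM.

Section Construction.
Context {da : Order.disp_t} (aleph : bOrderType da) (K : fieldType).

(* The set X(P) indexing the rows and columns. *)
Definition mindex {d : Order.disp_t} (P : porderType d) : Type :=
  (finsupp aleph P * mchain P)%type.
HB.instance Definition _ d (P : porderType d) := Choice.on (mindex P).

Context {d : Order.disp_t} (I : porderType d).
Implicit Types (i j : I).
Local Notation Q := (cfm K (mindex I)).

Lemma finsupp_restr_subproof (i : I) (p : finsupp aleph I) :
  finite_set [set k : up i | p (up_val k) != \bot%O].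
Proof.
apply: (@finite_preimage _ _ [set k | p k != \bot%O] (@up_val _ _ i)).
  by move=> x y _ _; exact: val_inj.
exact: finsuppP.
Qed.
Definition finsupp_restr i p : finsupp aleph (up i) :=
  FinSupp (finsupp_restr_subproof i p).

Lemma chain_restr_subproof (i : I) (A : mchain I) : (A : set I) i ->
  maximal_chain [set k : up i | (A : set I) (up_val k)].
Proof.
have [totA maxA] := mchainP A; move=> Ai; split=> [x y|B totB AB].
  by move=> Ax Ay; exact: totA.
have BA : A `|` (@up_val _ _ i @` B) = A.
  apply: maxA; last by move=> x; left.
  have mix (x : I) (y : up i) : (A : set I) x -> B y ->
      (x <= up_val y)%O \/ (up_val y <= x)%O.
    move=> Ax By; have [ix|xi] := totA i x Ai Ax.
      by apply: (totB (Up ix) y) => //; exact: AB.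
    by left; apply: le_trans (upP y).
  move=> x y [Ax|[x' Bx <-]] [Ay|[y' By <-]]; [exact: totA|exact: mix| |].
    by have [] := mix y x' Ay Bx; [right|left].
  exact: totB.
apply/seteqP; split; last exact: AB.
by move=> x Bx; rewrite /= -BA; right; exists x.
Qed.
Definition chain_restr i (A : mchain I) (Ai : (A : set I) i) : mchain (up i) :=
  MChain (chain_restr_subproof Ai).

Definition mindex_restr i (x : mindex I) (xi : (x.2 : set I) i) :
    mindex (up i) :=
  (finsupp_restr i x.1, chain_restr xi).

Definition psi_support i (x y : mindex I) :=
  [/\ (x.2 : set I) i, (y.2 : set I) i,
      x.2 `&` [set k | (k <= i)%O] = y.2 `&` [set k | (k <= i)%O]
    & forall k, ~ (i <= k)%O -> x.1 k = y.1 k].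

Definition psi_fun i (a : cfm K (mindex (up i))) (x y : mindex I) : K :=
  match pselect (psi_support i x y) with
  | left (And4 xi yi _ _) => a (mindex_restr xi) (mindex_restr yi)
  | right _ => 0
  end.

(* [glue i x u] replaces by [u] the part of [x] lying above [i]. *)
Lemma finsupp_glue_subproof i (p : finsupp aleph I) (q : finsupp aleph (up i)) :
  finite_set [set k | (if insub k is Some k' then q k' else p k) != \bot%O].
Proof.
apply: (@sub_finite_set _ _ ((@up_val _ _ i @` [set k | q k != \bot%O]) `|`
                            [set k | p k != \bot%O])).
  by move=> k /=; case: insubP => [k' _ <- h|_ h]; [left; exists k'|right].
by rewrite finite_setU; split; [apply: finite_image|]; exact: finsuppP.
Qed.
Definition finsupp_glue i p q := FinSupp (@finsupp_glue_subproof i p q).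

Lemma mchain_up_bot i (C : mchain (up i)) : (C : set (up i)) (Up (lexx i)).
Proof.
have [totC maxC] := mchainP C.
rewrite -(maxC ((C : set (up i)) `|` [set Up (lexx i)])).
- by right.
- by move=> x y [Cx|->] [Cy|->];
    [exact: totC|right; exact: (upP x)|left; exact: (upP y)|left; exact: lexx].
- by move=> x; left.
Qed.

Lemma chain_glue_subproof i (A : mchain I) (C : mchain (up i)) :
  (A : set I) i ->
  maximal_chain ((A `&` [set k | (k <= i)%O]) `|` (@up_val _ _ i @` C)).
Proof.
have [totA maxA] := mchainP A; have [totC maxC] := mchainP C.
move=> Ai; split=> [x y|B totB AB].
  move=> [[Ax /= xi]|[x' Cx <-]] [[Ay /= yi]|[y' Cy <-]];
    [exact: totA| | |exact: totC].
    by left; exact: le_trans (upP y').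
  by right; exact: le_trans (upP x').
have Bi : B i by apply: AB; left; split => //=.
have BC : [set k : up i | B (up_val k)] = C.
  apply: maxC => [x y Bx By|x Cx]; first exact: totB.
  by apply: AB; right; exists x.
have BA : (B `&` [set k | (k <= i)%O]) `|` (A `&` [set k | (i <= k)%O]) = A.
  apply: maxA => [x y|x Ax]; last first.
    have [ix|xi] := totA i x Ai Ax; first by right.
    by left; split => //; apply: AB; left.
  move=> [[Bx /= xi]|[Ax /= ix]] [[By /= yi]|[Ay /= iy]];
    [exact: totB| | |exact: totA].
    by left; exact: le_trans iy.
  by right; exact: le_trans ix.
apply/seteqP; split => //= x Bx; have [ix|xi] := totB i x Bi Bx.
  right; exists (Up ix) => //.
  by have : [set k : up i | B (up_val k)] (Up ix) by []; rewrite BC.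
by left; split => //; rewrite -BA; left.
Qed.
Definition chain_glue i A C Ai := MChain (@chain_glue_subproof i A C Ai).

Definition glue i (x : mindex I) (xi : (x.2 : set I) i) (u : mindex (up i)) :
  mindex I := (finsupp_glue x.1 u.1, chain_glue u.2 xi).

Lemma glue_mem i (x : mindex I) (xi : (x.2 : set I) i) u (k : up i) :
  ((glue xi u).2 : set I) (up_val k) <-> (u.2 : set (up i)) k.
Proof.
split=> [[[xk /= ki]|[k' uk' /val_inj <-//]]|uk]; last by right; exists k.
suff -> : k = Up (lexx i) by exact: mchain_up_bot.
by apply: val_inj; apply/le_anti; rewrite /= ki (upP k).
Qed.

Lemma glue_mem_le i (x : mindex I) (xi : (x.2 : set I) i) u k : (k <= i)%O ->
  ((glue xi u).2 : set I) k <-> (x.2 : set I) k.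
Proof.
move=> ki; split=> [[[]//|[k' uk' e]]|xk]; last by left.
rewrite -e in ki *; suff -> : up_val k' = i by [].
by apply/le_anti; rewrite ki upP.
Qed.

Lemma glue_base i (x : mindex I) (xi : (x.2 : set I) i) u :
  ((glue xi u).2 : set I) i.
Proof. by apply/glue_mem_le. Qed.

Lemma glue_val i (x : mindex I) (xi : (x.2 : set I) i) u (k : up i) :
  (glue xi u).1 (up_val k) = u.1 k.
Proof. by rewrite /= (valK k). Qed.

Lemma glue_val_out i (x : mindex I) (xi : (x.2 : set I) i) u k : ~ (i <= k)%O ->
  (glue xi u).1 k = x.1 k.
Proof. by move=> /negP ki; rewrite /= insubN. Qed.

Lemma mindex_eq (e : Order.disp_t) (P : porderType e) (x y : mindex P) :
  x.1 =1 y.1 -> (forall k, (x.2 : set P) k <-> (y.2 : set P) k) -> x = y.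
Proof.
case: x y => [p A] [q B] /= /finsupp_inj -> h; congr pair.
by apply: mchain_inj; apply/seteqP; split => k /h.
Qed.

Lemma restr_glue i (x : mindex I) (xi : (x.2 : set I) i) u
    (h : ((glue xi u).2 : set I) i) :
  mindex_restr h = u.
Proof. by apply: mindex_eq => k; [exact: glue_val|exact: glue_mem]. Qed.

Lemma psi_support_in i (x y : mindex I) k : psi_support i x y -> (k <= i)%O ->
  (x.2 : set I) k <-> (y.2 : set I) k.
Proof.
move=> [_ _ + _] ki => /seteqP[h1 h2].
by split=> h; [have [] := h1 k|have [] := h2 k].
Qed.

Lemma psi_supportE i (x y : mindex I) : (x.2 : set I) i -> (y.2 : set I) i ->
  (forall k, (k <= i)%O -> (x.2 : set I) k <-> (y.2 : set I) k) ->
  (forall k, ~ (i <= k)%O -> x.1 k = y.1 k) -> psi_support i x y.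
Proof.
by move=> xi yi h ?; split=> //; apply/seteqP; split=> k [? /= ki]; split=> //;
  apply/h.
Qed.

Lemma psi_support_sym i (x y : mindex I) :
  psi_support i x y -> psi_support i y x.
Proof. by move=> [? ? ? h]; split=> // k /h. Qed.

Lemma psi_support_trans i (x y z : mindex I) :
  psi_support i x y -> psi_support i y z -> psi_support i x z.
Proof.
by move=> [? ? e h] [? ? e' h']; split=> // [|k ik]; rewrite ?e // h ?h'.
Qed.

Lemma psi_support_glue i (x : mindex I) (xi : (x.2 : set I) i) u :
  psi_support i x (glue xi u).
Proof.
apply: psi_supportE => //; first exact: glue_base.
  by move=> k /(glue_mem_le xi u) ->.
by move=> k ?; rewrite glue_val_out.
Qed.

Lemma psi_support_glue2 i (x : mindex I) (xi : (x.2 : set I) i) u v :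
  psi_support i (glue xi u) (glue xi v).
Proof.
apply: psi_support_trans (psi_support_glue xi v).
exact/psi_support_sym/psi_support_glue.
Qed.

Lemma glue_restr i (x y : mindex I)
    (xi : (x.2 : set I) i) (yi : (y.2 : set I) i) :
  psi_support i x y -> glue xi (mindex_restr yi) = y.
Proof.
move=> xy; apply: mindex_eq => k; have [ik|ik] := pselect (i <= k)%O.
- by rewrite (glue_val xi (mindex_restr yi) (Up ik)).
- by rewrite glue_val_out //; case: xy => _ _ _ ->.
- by rewrite (glue_mem xi (mindex_restr yi) (Up ik)).
- have [totA maxA] := mchainP y.2.
  split=> [[[xk /= ki]|[k' yk' <-//]]|yk].
    by apply/(psi_support_in xy ki).
  have [//|ki] := totA i k yi yk.
  by apply/(glue_mem_le xi _ ki)/(psi_support_in xy ki).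
Qed.

Lemma psi_funE i a (x y : mindex I)
    (xi : (x.2 : set I) i) (yi : (y.2 : set I) i) :
  psi_support i x y -> psi_fun a x y = a (mindex_restr xi) (mindex_restr yi).
Proof.
rewrite /psi_fun; case: pselect => // -[xi' yi' ? ?] _.
by rewrite (Prop_irrelevance xi xi') (Prop_irrelevance yi yi').
Qed.

Lemma psi_fun_out i (a : cfm K (mindex (up i))) x y :
  ~ psi_support i x y -> psi_fun a x y = 0.
Proof. by rewrite /psi_fun; case: pselect. Qed.

Lemma psi_fun_neq0 i (a : cfm K (mindex (up i))) x y :
  psi_fun a x y != 0 -> psi_support i x y.
Proof.
by move=> h; apply: contrapT => /(psi_fun_out a) e; move: h; rewrite e eqxx.
Qed.

Lemma psi_fun_glue i a (x : mindex I) (xi : (x.2 : set I) i) u v :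
  psi_fun a (glue xi u) (glue xi v) = a u v.
Proof.
rewrite (psi_funE _ (glue_base xi u) (glue_base xi v)) ?restr_glue //.
exact: psi_support_glue2.
Qed.

Lemma psi_subproof i (a : cfm K (mindex (up i))) : column_finite (psi_fun a).
Proof.
apply/asboolP => y; have [yi|yi] := pselect ((y.2 : set I) i); last first.
  apply: (@sub_finite_set _ _ set0) => // x /= /psi_fun_neq0[_ yi' _ _].
  exact: yi.
apply: (@sub_finite_set _ _
  (glue yi @` [set u | a u (mindex_restr yi) != 0])); last first.
  by apply: finite_image; exact: cfm_colP.
move=> x /= h; have xy := psi_fun_neq0 h; have [xi _ _ _] := xy.
exists (mindex_restr xi); last by apply/glue_restr/psi_support_sym.
by move: h; rewrite (psi_funE _ xi yi).
Qed.
Definition psi i a : Q := CFM (@psi_subproof i a).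

Lemma psiD i (a b : cfm K (mindex (up i))) : psi (a + b) = psi a + psi b.
Proof.
apply: cfmP => x y; rewrite cfmD /= /psi_fun.
by case: pselect => [[]|_]; rewrite ?addr0.
Qed.

Lemma psiZ i c (a : cfm K (mindex (up i))) : psi (c *: a) = c *: psi a.
Proof.
apply: cfmP => x y; rewrite cfmZ /= /psi_fun.
by case: pselect => [[]|_]; rewrite ?mulr0.
Qed.

Lemma psiN i (a : cfm K (mindex (up i))) : psi (- a) = - psi a.
Proof. by rewrite -scaleN1r psiZ scaleN1r. Qed.

Definition Hi i : set Q :=
  [set q |
    (~ maximal_element i /\
       exists2 a : cfm K (mindex (up i)), finite_rows a & q = psi a) \/
    (maximal_element i /\
       exists c : K, q = c *: psi (1 : cfm K (mindex (up i))))].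

(* The internal sum of the [Hi j]: finite sums of elements of their union. *)
Definition H (J : set I) : set Q :=
  [set q | exists s : seq Q,
    (forall r, r \in s -> exists2 j, J j & Hi j r) /\ q = \sum_(r <- s) r].

Lemma HiN i q : Hi i q -> Hi i (- q).
Proof.
move=> [[mi [a fa ->]]|[mi [c ->]]]; [left|right]; split => //; last first.
  by exists (- c); rewrite scaleNr.
exists (- a); last by rewrite psiN.
by apply: sub_finite_set fa => x [y h]; exists y; rewrite -oppr_eq0; exact: h.
Qed.

Definition H_pred J : {pred Q} := fun q => `[< H J q >].

Lemma H_zmod_closed J : zmod_closed (H_pred J).
Proof.
split; first by apply/asboolP; exists [::]; rewrite big_nil.
move=> p q /asboolP[s [hs ->]] /asboolP[t [ht ->]]; apply/asboolP.
exists (s ++ [seq - r | r <- t]); split; last first.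
  by rewrite big_cat big_map /= -sumrN.
move=> r; rewrite mem_cat => /orP[/hs //|/mapP[r' /ht[j Jj h] ->]].
by exists j => //; exact: HiN.
Qed.

Lemma psi_uniform i j (b : cfm K (mindex (up j))) (x y : mindex I)
    (xi : (x.2 : set I) i) (yi : (y.2 : set I) i) u v : (i <= j)%O ->
  psi b (glue xi u) (glue xi v) = psi b (glue yi u) (glue yi v).
Proof.
move=> ij.
have mem (k : up j) (z : mindex I) (zi : (z.2 : set I) i) w :
    ((glue zi w).2 : set I) (up_val k) <->
    (w.2 : set (up i)) (Up (le_trans ij (upP k))).
  exact: (glue_mem zi w (Up (le_trans ij (upP k)))).
have val (k : up j) (z : mindex I) (zi : (z.2 : set I) i) w :
    (glue zi w).1 (up_val k) = w.1 (Up (le_trans ij (upP k))).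
  exact: (glue_val zi w (Up (le_trans ij (upP k)))).
have supp (z t : mindex I) (zi : (z.2 : set I) i) (ti : (t.2 : set I) i) :
    psi_support j (glue zi u) (glue zi v) ->
    psi_support j (glue ti u) (glue ti v).
  move=> h; have [uj vj _ hout] := h.
  have memj (s : mindex I) (si : (s.2 : set I) i) w :
    ((glue si w).2 : set I) j <-> (w.2 : set (up i)) (Up ij).
    exact: (glue_mem si w (Up ij)).
  apply: psi_supportE; [by apply/memj; move/memj: uj
                       |by apply/memj; move/memj: vj| |].
    move=> k kj; have [ik|ik] := pselect (i <= k)%O.
      have := psi_support_in h kj.
      by rewrite !(glue_mem _ _ (Up ik)).
    split=> [] [[tk /= ki]|[k' ? e]]; try by left.
      by case: ik; rewrite -e upP.
    by case: ik; rewrite -e upP.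
  move=> k jk; have [ik|ik] := pselect (i <= k)%O.
    by have := hout k jk; rewrite !(glue_val _ _ (Up ik)).
  by rewrite !glue_val_out.
have [h|h] := pselect (psi_support j (glue xi u) (glue xi v)); last first.
  rewrite /= !psi_fun_out //; by move=> /supp.
have h' := supp _ _ xi yi h.
have [a1 a2 _ _] := h; have [b1 b2 _ _] := h'.
rewrite /= (psi_funE _ a1 a2) // (psi_funE _ b1 b2) //; congr (entry b _ _).
  apply: mindex_eq => k; first by rewrite -[LHS]/((glue xi u).1 (up_val k)) val
    -[RHS]/((glue yi u).1 (up_val k)) val.
  exact: (iff_trans (mem k _ xi u) (iff_sym (mem k _ yi u))).
apply: mindex_eq => k; first by rewrite -[LHS]/((glue xi v).1 (up_val k)) val
  -[RHS]/((glue yi v).1 (up_val k)) val.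
exact: (iff_trans (mem k _ xi v) (iff_sym (mem k _ yi v))).
Qed.

Lemma psi_support_le i j (x y : mindex I) : (i <= j)%O -> (x.2 : set I) i ->
  psi_support j x y -> psi_support i x y.
Proof.
move=> ij xi h; have [xj yj _ hout] := h.
apply: psi_supportE => //; first by apply/(psi_support_in h ij).
  by move=> k ki; apply: (psi_support_in h); exact: le_trans ij.
by move=> k ik; apply: hout => jk; apply: ik; exact: le_trans jk.
Qed.

Lemma block_subproof i (x0 : mindex I) (xi : (x0.2 : set I) i) (r : Q) :
  column_finite (fun u v => r (glue xi u) (glue xi v)).
Proof.
apply/asboolP => v.
apply: (@finite_preimage _ _ [set x | r x (glue xi v) != 0] (glue xi)).
  move=> u w _ _ e.
  by rewrite -(restr_glue (glue_base xi u)) -(restr_glue (glue_base xi w));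
    move: (glue_base xi u); rewrite e => h; congr mindex_restr;
    exact: Prop_irrelevance.
exact: cfm_colP.
Qed.
Definition block i (x0 : mindex I) (xi : (x0.2 : set I) i) r : cfm K _ :=
  CFM (block_subproof xi r).

Lemma block_psi i (x0 : mindex I) (xi : (x0.2 : set I) i) a :
  block xi (psi a) = a.
Proof. by apply: cfmP => u v; exact: psi_fun_glue. Qed.

Lemma glue_inj i (x : mindex I) (xi : (x.2 : set I) i) : injective (glue xi).
Proof.
move=> u w e; rewrite -(restr_glue (glue_base xi u)).
by move: (glue_base xi u); rewrite e => h; exact: restr_glue.
Qed.

Lemma sum_block i (x : mindex I) (xi : (x.2 : set I) i) (F : mindex I -> K) :
  (forall y, F y != 0 -> psi_support i x y) ->
  \sum_(y \in [set: mindex I]) F y =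
  \sum_(u \in [set: mindex (up i)]) F (glue xi u).
Proof.
move=> hF; rewrite -(reindex_fsbig (glue xi) [set: _] (range (glue xi))).
  apply/esym/fsbig_widen => // y [_ ny] /=; apply: contrapT => /eqP /hF h.
  have [_ yi _ _] := h; apply: ny; exists (mindex_restr yi) => //.
  exact: glue_restr.
by apply: inj_bij => u w _ _; exact: glue_inj.
Qed.

Lemma psi_mulr i j (x0 : mindex I) (xi : (x0.2 : set I) i) a
    (b : cfm K (mindex (up j))) : (i <= j)%O ->
  psi a * psi b = psi (a * block xi (psi b)).
Proof.
move=> ij; apply: cfmP => x z.
have key y : psi a x y * psi b y z != 0 ->
    psi_support i x y /\ psi_support i y z.
  rewrite mulf_eq0 negb_or => /andP[/psi_fun_neq0 h /psi_fun_neq0 h'].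
  by split => //; have [_ yi _ _] := h; exact: psi_support_le h'.
have [h|h] := pselect (psi_support i x z); last first.
  rewrite [RHS]psi_fun_out //; apply: fsbig1 => y _; apply/eqP.
  apply: contrapT => /negP /key[h1 h2]; apply: h.
  exact: psi_support_trans h2.
have [xx zz _ _] := h.
rewrite cfmM (sum_block xx); last by move=> y /key[].
rewrite [RHS](psi_funE _ xx zz) // cfmM; apply: eq_fsbigr => u _; congr (_ * _).
  rewrite -[LHS]/(psi_fun a x (glue xx u)) (psi_funE _ xx (glue_base xx u)).
    by rewrite restr_glue.
  exact: psi_support_glue.
rewrite -{1}(glue_restr xx zz h); exact: psi_uniform.
Qed.

Lemma psi_mull i j (x0 : mindex I) (xi : (x0.2 : set I) i) a
    (b : cfm K (mindex (up j))) : (i <= j)%O ->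
  psi b * psi a = psi (block xi (psi b) * a).
Proof.
move=> ij; apply: cfmP => x z.
have key y : psi b x y * psi a y z != 0 ->
    psi_support i x y /\ psi_support i y z.
  rewrite mulf_eq0 negb_or => /andP[/psi_fun_neq0 h' /psi_fun_neq0 h].
  split => //; have [yi _ _ _] := h.
  by apply/psi_support_sym/(psi_support_le ij yi)/psi_support_sym.
have [h|h] := pselect (psi_support i x z); last first.
  rewrite [RHS]psi_fun_out //; apply: fsbig1 => y _; apply/eqP.
  apply: contrapT => /negP /key[h1 h2]; apply: h.
  exact: psi_support_trans h2.
have [xx zz _ _] := h.
rewrite cfmM (sum_block xx); last by move=> y /key[].
rewrite [RHS](psi_funE _ xx zz) // cfmM; apply: eq_fsbigr => u _; congr (_ * _).
  have xE : glue xx (mindex_restr xx) = x.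
    by apply: glue_restr; split=> //.
  by rewrite -{1}xE; exact: psi_uniform.
rewrite -[LHS]/(psi_fun a (glue xx u) z) (psi_funE _ (glue_base xx u) zz).
  by rewrite restr_glue.
by apply: psi_support_trans h; exact/psi_support_sym/psi_support_glue.
Qed.

Lemma finite_rows_mulr (X : choiceType) (a b : cfm K X) :
  finite_rows a -> finite_rows (a * b).
Proof.
apply: sub_finite_set => x /= [z /cfm_mul_neq0[y [h _]]]; by exists y.
Qed.

Lemma finite_rows_mull (X : choiceType) (a b : cfm K X) :
  finite_rows a -> finite_rows (b * a).
Proof.
move=> fa; apply: (@sub_finite_set _ _
  (\bigcup_(y in [set y | exists z, a y z != 0]) [set x | b x y != 0])).
  by move=> x /= [z /cfm_mul_neq0[y [h1 h2]]]; exists y => //; exists z.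
by apply: bigcup_finite => [//|y _]; exact: cfm_colP.
Qed.

Lemma psi_nochain i (a : cfm K (mindex (up i))) :
  ~ (exists x : mindex I, (x.2 : set I) i) -> psi a = 0.
Proof.
move=> h; apply: cfmP => x y; apply: psi_fun_out => -[xi _ _ _].
by apply: h; exists x.
Qed.

Lemma Hi_psi i q : Hi i q -> exists a : cfm K (mindex (up i)), q = psi a.
Proof.
move=> [[_ [a _ ->]]|[_ [c ->]]]; first by exists a.
by exists (c *: (1 : cfm K (mindex (up i)))); rewrite psiZ.
Qed.

Lemma Hi0 i : Hi i 0.
Proof.
have [mi|mi] := pselect (maximal_element i); [right|left]; split => //.
  by exists 0; rewrite scale0r.
exists 0; last by rewrite -[0 in RHS](scale0r 0) psiZ scale0r.
by apply: (@sub_finite_set _ _ set0) => // x /= [y]; rewrite eqxx.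
Qed.

Lemma HiM i j p q : Hi i p -> Hi j q -> Hi i (p * q) \/ Hi j (p * q).
Proof.
move=> hp hq.
have [x0|] := pselect (exists x : mindex I, (x.2 : set I) i); last first.
  move=> n; have [a ->] := Hi_psi hp; rewrite psi_nochain // mul0r.
  by left; exact: Hi0.
have [y0|] := pselect (exists x : mindex I, (x.2 : set I) j); last first.
  move=> n; have [a ->] := Hi_psi hq; rewrite (psi_nochain _ n) mulr0.
  by left; exact: Hi0.
have [x xi] := x0; have [y yj] := y0.
have [ij|nij] := pselect (i <= j)%O; last have [ji|nji] := pselect (j <= i)%O.
- left; have [b qb] := Hi_psi hq; subst q.
  case: hp => [[mi [a fa ->]]|[mi [c ->]]].
    left; split => //; exists (a * block xi (psi b)).
      exact: finite_rows_mulr.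
    exact: psi_mulr.
  have e := mi j ij; subst j.
  case: hq => [[mi' _]|[_ [c' ->]]]; first by [].
  right; split => //; exists (c * c').
  rewrite -!psiZ (psi_mulr xi) // block_psi; congr psi.
  apply: cfmP => u v; rewrite cfmM (@fsum_seq _ _ [:: u]) //.
    by rewrite big_seq1 !cfmZ !cfm1 eqxx mulr1 mulrA.
  by move=> w; rewrite inE eq_sym => /negbTE h; rewrite cfmZ cfm1 h mulr0 mul0r.
- right; have [b pb] := Hi_psi hp; subst p.
  case: hq => [[mj [a fa ->]]|[mj [c ->]]].
    left; split => //; exists (block yj (psi b) * a).
      exact: finite_rows_mull.
    exact: psi_mull.
  by case: nij; rewrite (mj i ji).
- left; have [a ->] := Hi_psi hp; have [b ->] := Hi_psi hq.
  suff -> : psi a * psi b = 0 by exact: Hi0.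
  apply: cfmP => z t; apply: fsbig1 => w _; apply/eqP.
  apply: contrapT => /negP; rewrite mulf_eq0 negb_or => /andP[].
  move=> /psi_fun_neq0[_ wi _ _] /psi_fun_neq0[wj _ _ _].
  by have [tot _] := mchainP w.2; have [] := tot i j wi wj.
Qed.

Lemma H_add J p q : H J p -> H J q -> H J (p + q).
Proof.
move=> [s [hs ->]] [t [ht ->]]; exists (s ++ t); split; last by rewrite big_cat.
by move=> r; rewrite mem_cat => /orP[/hs|/ht].
Qed.

Lemma H_sum J (T : eqType) (s : seq T) (F : T -> Q) :
  (forall t, t \in s -> H J (F t)) -> H J (\sum_(t <- s) F t).
Proof.
elim: s => [|t s ih] h; first by rewrite big_nil; exists [::]; rewrite big_nil.
rewrite big_cons; apply: H_add; first by apply: h; rewrite mem_head.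
by apply: ih => t' ?; apply: h; rewrite inE; apply/orP; right.
Qed.

Lemma H_Hi J j q : J j -> Hi j q -> H J q.
Proof.
move=> Jj hq; exists [:: q]; split; last by rewrite big_seq1.
by move=> r; rewrite inE => /eqP ->; exists j.
Qed.

Lemma HM J p q : H J p -> H J q -> H J (p * q).
Proof.
move=> [s [hs ->]] [t [ht ->]]; rewrite mulr_suml; apply: H_sum => r rs.
rewrite mulr_sumr; apply: H_sum => r' r't.
have [i Ji hi] := hs r rs; have [j Jj hj] := ht r' r't.
by have [h|h] := HiM hi hj; [exact: H_Hi Ji h|exact: H_Hi Jj h].
Qed.

Lemma chain_top (A : mchain I) (j : I) :
  has_finite_cofinal I -> (A : set I) j ->
  exists m, [/\ (A : set I) m, maximal_element m & (j <= m)%O].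
Proof.
move=> [F finF cofF] Aj; have [totA maxA] := mchainP A.
suff [f hf] : exists f, forall a, (A : set I) a -> (a <= f)%O.
  have top k : (f <= k)%O -> (A : set I) k.
    move=> fk; rewrite -(maxA ((A : set I) `|` [set k])); first by right.
      have ak a : (A : set I) a -> (a <= k)%O.
        by move=> /hf h; exact: le_trans fk.
      move=> x y [Ax|->] [Ay|->]; [exact: totA|left; exact: ak
        |right; exact: ak|by left].
    by move=> x; left.
  exists f; split; [exact: top| |exact: hf].
  by move=> k fk; apply/le_anti; rewrite fk hf //; exact: top.
apply: contrapT => /forallNP nf.
have [s sF] : exists s : seq I, forall f, F f -> f \in s.
  by exists (fset_set F) => f Ff; rewrite in_fset_set // inE.
have [a Aa ha] : exists2 a, (A : set I) a & forall f, f \in s -> ~ (a <= f)%O.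
  elim: s {sF} => [|f s [a Aa ha]]; first by exists j.
  have [b Ab bf] : exists2 b, (A : set I) b & ~ (b <= f)%O.
    apply: contrapT => /forall2NP h; apply: (nf f) => b Ab.
    by have [] := h b => //; exact: contrapT.
  have [ab|ba] := totA a b Aa Ab.
    exists b => // g; rewrite inE => /orP[/eqP -> //|/ha h bg].
    by apply: h; exact: le_trans bg.
  exists a => // g; rewrite inE => /orP[/eqP -> af|/ha //].
  by apply: bf; exact: le_trans af.
by have [f Ff af] := cofF a; exact: (ha f (sF f Ff)).
Qed.

Lemma psi1E i (x y : mindex I) :
  psi (1 : cfm K (mindex (up i))) x y =
  ((x == y) && `[< (x.2 : set I) i >])%:R.
Proof.
have [->|ne] := eqVneq x y => /=.
  have [yi|yi] := pselect ((y.2 : set I) i); last first.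
    by rewrite asboolF // psi_fun_out // => -[].
  by rewrite asboolT // (psi_funE _ yi yi) // cfm1 eqxx.
have [h|h] := pselect (psi_support i x y); last by rewrite psi_fun_out.
have [xi yi _ _] := h; rewrite (psi_funE _ xi yi) // cfm1.
case: eqP => // e; move/eqP: ne; case.
by rewrite -(glue_restr xi yi h) -e glue_restr //.
Qed.

Lemma H_has_one J : has_finite_cofinal I -> upper_subset J ->
  exists e : Q, H J e /\ forall q, H J q -> e * q = q /\ q * e = q.
Proof.
move=> hI hJ.
have [s us hs] : exists2 s : seq I, uniq s &
    forall m, m \in s <-> J m /\ maximal_element m.
  have [F finF cofF] := hI.
  have fs : finite_set [set m | J m /\ maximal_element m].
    apply: sub_finite_set finF => m [_ mm].
    by have [f Ff /mm <-] := cofF m.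
  exists (fset_set [set m | J m /\ maximal_element m]); first exact: fset_uniq.
  move=> m.
  by rewrite in_fset_set // inE.
pose n (x : mindex I) : K := \sum_(m <- s) `[< (x.2 : set I) m >]%:R.
pose e : Q := \sum_(m <- s) psi (1 : cfm K (mindex (up m))).
have eE x y : e x y = (x == y)%:R * n x.
  have -> : e x y = \sum_(m <- s) psi (1 : cfm K (mindex (up m))) x y.
    rewrite /e; elim: (s) => [|m t ih]; first by rewrite !big_nil.
    by rewrite !big_cons cfmD ih.
  rewrite /n mulr_sumr; apply: eq_bigr => m _.
  by rewrite psi1E -natrM mulnb.
have n1 (x : mindex I) j : J j -> (x.2 : set I) j -> n x = 1.
  move=> Jj xj; have [m [xm mm jm]] := chain_top hI xj.
  have ms : m \in s by apply/hs; split=> //; exact: hJ jm.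
  rewrite /n (bigD1_seq m) //= asboolT // big_seq_cond big1 ?addr0 // => k.
  move=> /andP[/hs[Jk mk] /eqP km]; rewrite asboolF // => xk.
  have [tot _] := mchainP x.2; have [h|h] := tot k m xk xm.
    by apply: km; rewrite (mk m h).
  by apply: km; rewrite (mm k h).
exists e; split.
  apply: H_sum => m /hs[Jm mm]; apply: H_Hi Jm _; right; split => //.
  by exists 1; rewrite scale1r.
move=> q [t [ht ->]]; rewrite mulr_sumr mulr_suml.
suff hh r : r \in t -> e * r = r /\ r * e = r.
  by split; rewrite big_seq [RHS]big_seq; apply: eq_bigr => r /hh[].
move=> /ht[j Jj /Hi_psi[a ->]]; split; apply: cfmP => x z; rewrite cfmM.
  rewrite (@fsum_seq _ _ [:: x]) //; last first.
    by move=> y; rewrite inE eq_sym => /negbTE h; rewrite eE h !mul0r.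
  rewrite big_seq1 eE eqxx mul1r.
  have [->|/psi_fun_neq0[xj _ _ _]] := eqVneq (psi a x z) 0.
    by rewrite mulr0.
  by rewrite (n1 _ _ Jj xj) mul1r.
rewrite (@fsum_seq _ _ [:: z]) //; last first.
  by move=> y; rewrite inE => /negbTE h; rewrite eE h mul0r mulr0.
rewrite big_seq1 eE eqxx mul1r.
have [->|/psi_fun_neq0[_ zj _ _]] := eqVneq (psi a x z) 0.
  by rewrite mul0r.
by rewrite (n1 _ _ Jj zj) mulr1.
Qed.

(* The identity of [H J] exists because [I] has a finite cofinal subset and
   [J] is an upper subset; it differs from that of [Q] in general. *)
Record H_ring (J : set I) (hI : has_finite_cofinal I) (hJ : upper_subset J) :=
  HRing { H_val :> Q; _ : H_pred J H_val }.

Section Ring.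
Context (J : set I) (hI : has_finite_cofinal I) (hJ : upper_subset J).
Local Notation HR := (H_ring hI hJ).

HB.instance Definition _ := [isSub for @H_val J hI hJ].
HB.instance Definition _ := [Choice of HR by <:].
HB.instance Definition _ := GRing.isZmodClosed.Build Q
  (H_pred J) (H_zmod_closed J).
HB.instance Definition _ := [SubChoice_isSubZmodule of HR by <:].

Lemma H_valP (a : HR) : H J (H_val a).
Proof. by have /asboolP := valP a; exact. Qed.

Definition H_mul (a b : HR) : HR :=
  HRing hI hJ (asboolT (HM (H_valP a) (H_valP b))).

Definition H_one : HR :=
  HRing hI hJ (asboolT (proj1 (svalP (cid (H_has_one hI hJ))))).

Lemma H_mulA : associative H_mul.
Proof. by move=> a b c; apply: val_inj; exact: mulrA. Qed.

Lemma H_mul1 : left_id H_one H_mul.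
Proof.
move=> a; apply: val_inj => /=.
by case: (cid _) => e [/= _ he]; have [] := he _ (H_valP a).
Qed.

Lemma H_mulr1 : right_id H_one H_mul.
Proof.
move=> a; apply: val_inj => /=.
by case: (cid _) => e [/= _ he]; have [] := he _ (H_valP a).
Qed.

Lemma H_mulDl : left_distributive H_mul +%R.
Proof. by move=> a b c; apply: val_inj; exact: mulrDl. Qed.

Lemma H_mulDr : right_distributive H_mul +%R.
Proof. by move=> a b c; apply: val_inj; exact: mulrDr. Qed.

HB.instance Definition _ := GRing.Zmodule_isPzRing.Build HR
  H_mulA H_mul1 H_mulr1 H_mulDl H_mulDr.

End Ring.

End Construction.

Arguments H_ring {da} aleph K {d I J} hI hJ.

Section Rings.
Context (R : pzRingType).

Definition prime_ring :=
  (1 : R) != 0 /\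
  forall a b : R, (forall r : R, a * r * b = 0) -> a = 0 \/ b = 0.

Definition simple_module (M : lmodType R) :=
  (exists m : M, m != 0) /\
  forall N : {pred M}, submod_closed N ->
    (forall m, m \in N -> m = 0) \/ (forall m, m \in N).

Definition faithful_module (M : lmodType R) :=
  forall r : R, (forall m : M, r *: m = 0) -> r = 0.

(* A primitive ring is nonzero, since its faithful module is. *)
Definition left_primitive :=
  exists M : lmodType R, simple_module M /\ faithful_module M.

End Rings.

(* Left modules over the converse ring are right modules. *)
Definition right_primitive (R : pzRingType) := left_primitive R^c.

(* Main.v *)
Require Import Defs.
From HB Require Import structures.
From mathcomp Require Import all_boot all_order all_algebra.
From mathcomp Require Import cardinality fsbigop filter.
From mathcomp Require Import boolp classical_sets.

(* Every nonzero q in H(J) acts nontrivially on every block of level z, for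
   each z below the levels of q: a block of a maximal level of q can be placed,
   by its finitely supported coordinate in the infinite set aleph, outside the
   finitely many nonzero rows of the lower levels.  When z is not maximal, the
   matrix units of FR at level z then give primeness for J directed.  When J
   has a coinitial chain, fix an index x whose maximal chain contains it: the
   columns (resp. rows) at x of the elements of H(J) form a faithful simple
   left (resp. right) module.

   Conversely, let M be faithful simple and m <> 0 in M.  For each k in J the
   ideal of the levels below k contains some b_k fixing m, so that 1 - b_k
   annihilates m.  Let S_k be the finite set of levels of b_k.  If no maximal
   chain met all of S_k1, ..., S_kn, then b_k would vanish, for each index x, in
   the row and the column x for some k = k_l, and the identity would split as a
   sum of diagonal projections d_l with d_l b_kl = b_kl d_l = 0.  Elements of
   sufficiently low level can be multiplied by the d_l inside H(J), so they
   would all annihilate m, although some b_z fixes it.  An ultrafilter on the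
   set of maximal chains now yields a coinitial chain, made of elements of the
   S_k. *)

Local Open Scope classical_set_scope.

Section Lemmas.
Set Implicit Arguments.
Unset Strict Implicit.
Unset Printing Implicit Defensive.
Import Order.TTheory GRing.Theory.
Local Open Scope ring_scope.

(** * Faithful simple modules over an arbitrary ring *)

Section Primitivity.

(** If [b] moves some [n] to a nonzero vector, the submodule generated by [b *: n] is the whole
    module, so [a r b = 0] for all [r] makes [a] act as zero. *)
Lemma left_primitive_prime (R : pzRingType) : left_primitive R -> prime_ring R.
Proof.
move=> [M [[[m m0] simM] fM]]; split.
  by apply: contraNN (m0) => /eqP e; rewrite -(scale1r m) e scale0r.
move=> a b ab; have [|b0] := pselect (b = 0); first by right.
left; apply: (fM) => m'.
have [n bn] : exists n : M, b *: n != 0.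
  apply: contrapT => /forallNP h; apply: b0; apply: fM => n.
  by apply/eqP/negPn/negP; exact: h.
pose N : {pred M} := fun v => `[< exists r : R, v = r *: (b *: n) >].
have subN : submod_closed N.
  split; first by apply/asboolP; exists 0; rewrite scale0r.
  move=> c u v /asboolP[r ->] /asboolP[r' ->]; apply/asboolP.
  by exists (c * r + r'); rewrite scalerDl !scalerA.
have [N0|NM] := simM N subN.
  case/eqP: bn; apply: N0; apply/asboolP.
  by exists 1; rewrite scale1r.
by have /asboolP[r ->] := NM m'; rewrite !scalerA ab scale0r.
Qed.

Lemma prime_converse (R : pzRingType) : prime_ring R^c -> prime_ring R.
Proof.
move=> [h1 h]; split=> // a b ab.
by have [] := h b a; [move=> r; rewrite -[LHS]mulrA; exact: ab|right|left].
Qed.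

Section Criterion.
Context (R : pzRingType) (V : zmodType) (phi : R -> V).
Hypothesis phiB : {morph phi : a b / a - b}.
Hypothesis phiK : forall r a, phi a = 0 -> phi (r * a) = 0.

(** By [phiB] and [phiK] the kernel of [phi] is a left ideal. The image of [phi] stands for the
    quotient of [R] by it, with scalars acting through chosen preimages. *)
Definition orbit_pred : {pred V} := fun v => `[< exists a, phi a = v >].

Record orbit := Orbit { orbit_val :> V; _ : orbit_pred orbit_val }.
HB.instance Definition _ := [isSub for orbit_val].
HB.instance Definition _ := [Choice of orbit by <:].

Lemma orbit_zmod_closed : zmod_closed orbit_pred.
Proof.
split; first by apply/asboolP; exists 0; rewrite -(subrr 0) phiB subrr.
by move=> u v /asboolP[a <-] /asboolP[b <-]; apply/asboolP; exists (a - b).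
Qed.
HB.instance Definition _ :=
  GRing.isZmodClosed.Build V orbit_pred orbit_zmod_closed.
HB.instance Definition _ := [SubChoice_isSubZmodule of orbit by <:].

Lemma orbit_class_subproof (a : R) : orbit_pred (phi a).
Proof. by apply/asboolP; exists a. Qed.
Definition orbit_class a : orbit := Orbit (orbit_class_subproof a).

Lemma orbit_classP (v : orbit) : exists a, v = orbit_class a.
Proof. by have /asboolP[a e] := valP v; exists a; apply: val_inj. Qed.

Definition orbit_repr v := projT1 (cid (orbit_classP v)).

Definition orbit_scale (r : R) (v : orbit) := orbit_class (r * orbit_repr v).

Lemma orbit_classB a b : orbit_class (a - b) = orbit_class a - orbit_class b.
Proof. by apply: val_inj; exact: phiB. Qed.

Lemma orbit_class_eq a b : orbit_class a = orbit_class b <-> phi (a - b) = 0.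
Proof.
by rewrite phiB; split=> [/(congr1 val) /= ->|/subr0_eq e];
  [rewrite subrr|exact: val_inj].
Qed.

Lemma orbit_classD a b : orbit_class (a + b) = orbit_class a + orbit_class b.
Proof.
have e c : orbit_class (- c) = - orbit_class c.
  rewrite -[- c]add0r orbit_classB -[X in orbit_class X](subrr 0).
  by rewrite orbit_classB subrr sub0r.
by rewrite -[b]opprK orbit_classB e !opprK.
Qed.

(** Two preimages differ by an element of the kernel, a left ideal, so the chosen representative
    does not matter. *)
Lemma orbit_scaleE r a : orbit_scale r (orbit_class a) = orbit_class (r * a).
Proof.
apply/orbit_class_eq; rewrite -mulrBr; apply: phiK; apply/orbit_class_eq.
by rewrite /orbit_repr; case: cid.
Qed.

Lemma orbit_scaleA r s v :
  orbit_scale r (orbit_scale s v) = orbit_scale (r * s) v.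
Proof. by have [a ->] := orbit_classP v; rewrite !orbit_scaleE mulrA. Qed.
Lemma orbit_scale1 : left_id 1 orbit_scale.
Proof.
by move=> v; have [a ->] := orbit_classP v; rewrite orbit_scaleE mul1r.
Qed.
Lemma orbit_scaleDr : right_distributive orbit_scale +%R.
Proof.
move=> r u v; have [a ->] := orbit_classP u; have [b ->] := orbit_classP v.
by rewrite -orbit_classD !orbit_scaleE mulrDr orbit_classD.
Qed.
Lemma orbit_scaleDl v : {morph orbit_scale^~ v : r s / r + s}.
Proof.
move=> r s; have [a ->] := orbit_classP v.
by rewrite !orbit_scaleE mulrDl orbit_classD.
Qed.
HB.instance Definition _ := GRing.Zmodule_isLmodule.Build R orbit
  orbit_scaleA orbit_scale1 orbit_scaleDr orbit_scaleDl.

(** The class of 1 generates the module, so simplicity reduces to carrying every nonzero class back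
    to it; the last hypothesis is faithfulness. *)
Lemma left_primitive_orbit : phi 1 != 0 ->
  (forall a, phi a != 0 -> exists r, phi (r * a) = phi 1) ->
  (forall a, a != 0 -> exists r, phi (a * r) != 0) ->
  left_primitive R.
Proof.
move=> phi1 phiS phiF; exists orbit.
have class0 a : orbit_class a = 0 <-> phi a = 0.
  by split=> [/(congr1 val)//|e]; exact: val_inj.
split; [split|].
- by exists (orbit_class 1); apply/eqP => /class0/eqP; apply/negP.
- move=> N [N0 NL]; have NZ r v : v \in N -> r *: v \in N.
    by move=> vN; rewrite -[r *: v]addr0; exact: NL.
  have [N'|N'] := pselect (forall m, m \in N -> m = 0); [by left|right] => m.
  have [n nN n0] : exists2 n, n \in N & n <> 0.
    by apply: contrapT => /forall2NP h; apply: N' => n nN;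
      have [|/contrapT] := h n.
  have [a ea] := orbit_classP n; have [b eb] := orbit_classP m.
  have [|r hr] := phiS a; first by apply/eqP => /class0; rewrite -ea.
  have -> : m = (b * r) *: n.
    rewrite eb ea -scalerA; apply/esym.
    have -> : r *: orbit_class a = orbit_class 1.
      by rewrite [LHS]orbit_scaleE; apply: val_inj.
    by rewrite [LHS]orbit_scaleE mulr1.
  exact: NZ.
- move=> a ha; apply/eqP/negPn/negP => /phiF[r /eqP]; apply; apply/class0.
  by rewrite -orbit_scaleE; exact: ha.
Qed.
End Criterion.

(** [L] is the annihilator of a nonzero vector [m] of a faithful simple module, and [b k] is an
    element of the ideal [A k] fixing [m], found because [A k] applied to [m] gives the whole
    module. *)
Lemma left_primitive_annihilator (R : pzRingType) (T : Type) (J : set T)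
    (A : T -> set R) : left_primitive R ->
  (forall k, J k -> [/\ A k 0, forall a b, A k a -> A k b -> A k (a + b),
     forall r a, A k a -> A k (r * a) /\ A k (a * r) &
     exists2 a, A k a & a != 0]) ->
  exists (b : T -> R) (L : set R),
    [/\ forall a c, L a -> L c -> L (a + c), forall r a, L a -> L (r * a) &
     forall k, J k -> [/\ A k (b k), L (1 - b k) & ~ L (b k)]].
Proof.
move=> [M [[[m m0] simM] fM]] hA.
have [k|b hb] := @choice _ _ (fun k b => J k -> A k b /\ b *: m = m).
  have [Jk|nJk] := pselect (J k); last by exists 0.
  have [A0 AD AM [a Aa a0]] := hA k Jk.
  pose N : {pred M} := fun v => `[< exists2 b, A k b & v = b *: m >].
  have subN : submod_closed N.
    split; first by apply/asboolP; exists 0; rewrite ?scale0r.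
    move=> c u v /asboolP[r Ar ->] /asboolP[r' Ar' ->]; apply/asboolP.
    by exists (c * r + r'); rewrite ?scalerDl ?scalerA //; apply: AD => //;
      have [] := AM c r Ar.
  have [N0|NM] := simM N subN; last by have /asboolP[b Ab e] := NM m; exists b.
  (* If [A k] kills [m], the submodule [N'] of all vectors killed by [A k] contains [m], hence is
     everything; a nonzero element of [A k] then contradicts faithfulness. *)
  pose N' : {pred M} := fun v => `[< forall b, A k b -> b *: v = 0 >].
  have subN' : submod_closed N'.
    split; first by apply/asboolP => b _; rewrite scaler0.
    move=> c u v /asboolP hu /asboolP hv; apply/asboolP => b Ab.
    by rewrite scalerDr hv // addr0 scalerA hu //; have [] := AM c b Ab.
  case/eqP: a0; apply: fM => m'.
  have [N0'|NM'] := simM N' subN'; last by have /asboolP := NM' m'; exact.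
  case/eqP: m0; apply: N0'; apply/asboolP => b Ab; apply: N0.
  by apply/asboolP; exists b.
exists b, [set a | a *: m = 0]; split=> /= [a c ha hc|r a ha|k /hb[Ab bm]].
- by rewrite scalerDl ha hc addr0.
- by rewrite -scalerA ha scaler0.
- by split=> //; rewrite ?bm ?scalerBl ?scale1r ?bm ?subrr //; apply/eqP.
Qed.
End Primitivity.

(** * Maximal chains, directed sets and coinitial chains *)

Section Chains.
Context {d : Order.disp_t} (P : porderType d).

Lemma mchain_extends (C : set P) :
  total_on C <=%O -> exists A : mchain P, C `<=` A.
Proof.
move=> totC.
(* Zorn's lemma is applied to the sets whose union with [C] is total, not to the chains containing
   [C], so that the empty union is admissible. *)
have [F tF FF|A [totA maxA]] := @Zorn_bigcup P
    (fun A => total_on (C `|` A) <=%O).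
  move=> x y [Cx|[X FX Xx]] [Cy|[Y FY Yy]]; first exact: totC.
  - by apply: (tF Y FY); [left|right].
  - by apply: (tF X FX); [right|left].
  - by have [XY|YX] := FF X Y FX FY; [apply: (tF Y FY)|apply: (tF X FX)]; right;
      auto.
have maxCA : maximal_chain (C `|` A).
  split=> // B totB CAB; apply: contrapT => ne.
  apply: (maxA B); last by rewrite setUidr // => x Cx; apply: CAB; left.
  split; first by move=> x Ax; apply: CAB; right.
  by move=> BA; apply: ne; apply/seteqP; split=> // x /BA; right.
by exists (MChain maxCA) => x; left.
Qed.

Lemma seq_maximal (s : seq P) (i : P) : i \in s ->
  exists2 m, m \in s & forall j, j \in s -> (m <= j)%O -> j = m.
Proof.
have [n] := ubnP (size s); elim: n s i => // n ih s i sn si.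
have [h|/existsNP[j /not_implyP[js /not_implyP[ij ji]]]] :=
  pselect (forall j, j \in s -> (i <= j)%O -> j = i); first by exists i.
have ij' : (i < j)%O by rewrite lt_neqAle ij andbT eq_sym; apply/eqP.
have [||m] := ih [seq k <- s | (i < k)%O] j.
- rewrite -ltnS; apply: leq_trans sn; rewrite ltnS size_filter.
  rewrite -(count_predC (fun k => (i < k)%O) s) -addn1 leq_add2l -has_count.
  by apply/hasP; exists i; rewrite //= ltxx.
- by rewrite mem_filter ij' js.
rewrite mem_filter => /andP[im ms] hm; exists m => // k ks mk.
by apply: hm => //; rewrite mem_filter ks andbT (lt_le_trans im mk).
Qed.

Lemma directed_lower_bound (J : set P) (s : seq P) : downward_directed J ->
  (forall i, i \in s -> J i) ->
  exists2 z, J z & forall i, i \in s -> (z <= i)%O.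
Proof.
move=> [[j0 Jj0] dirJ]; elim: s => [|i s ih] h; first by exists j0.
have [j js|z Jz hz] := ih; first by apply: h; rewrite inE js orbT.
have [w [Jw wz wi]] := dirJ z i Jz (h i (mem_head _ _)).
exists w => // j; rewrite inE => /orP[/eqP -> //|/hz]; exact: le_trans.
Qed.

Lemma coinitial_chain_directed (J : set P) :
  has_coinitial_chain J -> downward_directed J.
Proof.
move=> [C [[c Cc] CJ totC cofC]]; split; first by exists c; exact: CJ.
move=> x y /cofC[a Ca ax] /cofC[b Cb yb].
by have [ab|ba] := totC a b Ca Cb; [exists a|exists b]; split=> //;
  [exact: CJ|exact: le_trans yb|exact: CJ|exact: le_trans ax].
Qed.

Lemma coinitial_lower_bound (C J : set P) (s : seq P) :
  C !=set0 -> C `<=` J -> total_on C <=%O ->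
  (forall j, J j -> exists2 c, C c & (c <= j)%O) ->
  (forall i, i \in s -> J i) ->
  exists2 z, C z & forall i, i \in s -> (z <= i)%O.
Proof.
move=> C0 CJ totC cofC sJ.
have dirJ : downward_directed J.
  by apply: coinitial_chain_directed; exists C.
have [z /cofC[c Cc cz] hz] := directed_lower_bound dirJ sJ.
by exists c => // i /hz; exact: le_trans.
Qed.

(** If all elements of [J] are maximal, a common lower bound of two of them equals both. *)
Lemma directed_nonmaximal (J : set P) : downward_directed J ->
  (exists2 z, maximal_element z & J = [set z]) \/
  (exists2 z, J z & ~ maximal_element z).
Proof.
move=> [[j Jj] dirJ].
have [h|] := pselect (exists2 z, J z & ~ maximal_element z); first by right.
move=> /forall2NP h; left.
have mJ z : J z -> maximal_element z by have [|/contrapT] := h z.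
exists j; first exact: mJ.
apply/seteqP; split=> [k Jk|k -> //] /=.
have [z [Jz zk zj]] := dirJ k j Jk Jj.
by rewrite (mJ z Jz k zk) (mJ z Jz j zj).
Qed.

(* The chain is read off an ultrafilter [U] containing, for each [k], the set
   of the [A] meeting [S k]: it consists of the [i] such that [U] contains the
   set of the [A] through [i]. *)
Lemma coinitial_of_finite_choices (J : set P) (S : P -> seq P) : J !=set0 ->
  (forall k, J k -> forall i, i \in S k -> J i /\ (i <= k)%O) ->
  (forall s : seq P, (forall k, k \in s -> J k) ->
     exists A : mchain P, forall k, k \in s ->
       exists2 i, i \in S k & (A : set P) i) ->
  has_coinitial_chain J.
Proof.
move=> [j0 Jj0] SJ fip.
pose F : set_system (mchain P) := [set U | exists2 s : seq P,
  forall k, k \in s -> J k &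
  forall A : mchain P, (forall k, k \in s ->
     exists2 i, i \in S k & (A : set P) i) -> U A].
have pF : ProperFilter F.
  split; first by move=> [s /fip[A hA] h]; exact: (h A).
  split; first by exists [::].
  - move=> U V [s sJ hs] [t tJ ht]; exists (s ++ t).
      by move=> k; rewrite mem_cat => /orP[/sJ|/tJ].
    by move=> A hA; split; [apply: hs|apply: ht] => k ks; apply: hA;
      rewrite mem_cat ks ?orbT.
  - by move=> U V UV [s sJ hs]; exists s => // A /hs/UV.
have [U [uU FU]] := ultraFilterLemma pF.
have pU : ProperFilter U by exact: ultra_proper.
pose T i : set (mchain P) := [set A | (A : set P) i].
have UT k : J k -> exists2 i, i \in S k & U (T i).
  move=> Jk; apply: contrapT => /forall2NP h.
  (* If no [T i] with [i] in [S k] were in [U], the finite intersection of their complements would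
     be; it is disjoint from the set of chains meeting [S k], which is in [U]. *)
  have UN (s : seq P) : {subset s <= S k} ->
      U [set A : mchain P | forall i, i \in s -> ~ T i A].
    elim: s => [|i s ih] sS.
      by apply: filterS filterT => A _ i; rewrite in_nil.
    have [|UTi] := in_ultra_setVsetC (T i) uU.
      by have [] := h i; rewrite // sS ?mem_head.
    have Us : U [set A : mchain P | forall i, i \in s -> ~ T i A].
      by apply: ih => j js; apply: sS; rewrite inE js orbT.
    apply: filterS (filterI UTi Us).
    by move=> A [nA hA] j; rewrite inE => /orP[/eqP ->|/hA].
  have : U [set A : mchain P | exists2 i, i \in S k & T i A].
    by apply: FU; exists [:: k] => [l|A]; [rewrite inE => /eqP ->|
      apply; exact: mem_head].
  move=> /(filterI (UN (S k) (fun=> id))) /filter_ex[A [hA [i /hA]]].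
  by [].
exists [set i | J i /\ U (T i)]; split.
- by have [i /(SJ _ Jj0)[Ji _] Ui] := UT j0 Jj0; exists i.
- by move=> i [].
(* Two members of [U] intersect, so [x] and [y] lie on a common maximal chain. *)
- move=> x y [_ Ux] [_ Uy]; have [A [Ax Ay]] := filter_ex (filterI Ux Uy).
  by have [totA _] := mchainP A; exact: totA.
- move=> k Jk; have [i /(SJ _ Jk)[Ji ik] Ui] := UT k Jk.
  by exists i.
Qed.
End Chains.

(** * Matrix units and diagonal projections *)

Section Matrices.
Context (K : fieldType) (X : choiceType).
Implicit Types (a : cfm K X) (T : set X).

Lemma cfm_sumE (U : Type) (s : seq U) (F : U -> cfm K X) x y :
  (\sum_(t <- s) F t) x y = \sum_(t <- s) F t x y.
Proof. by elim: s => [|t s ih]; rewrite ?big_nil ?big_cons // cfmD ih. Qed.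

Lemma delta_subproof (c : K) (u v : X) :
  column_finite (fun x y => c *+ ((x == u) && (y == v))).
Proof.
apply/asboolP => y; apply: (@sub_finite_set _ _ [set u]) => // x /=.
by case: (x =P u) => [->|_] /=; rewrite ?eqxx.
Qed.
Definition delta c u v := CFM (delta_subproof c u v).

Lemma finite_rows_delta c u v : finite_rows (delta c u v).
Proof.
apply: (@sub_finite_set _ _ [set u]) => // x /= [y].
by case: (x =P u) => [->|_] /=; rewrite ?eqxx.
Qed.

Lemma mul_deltar a c u v x y : (a * delta c u v) x y = (a x u * c) *+ (y == v).
Proof.
rewrite cfmM (@fsum_seq _ _ [:: u]) //.
  by rewrite big_seq1 /= eqxx mulrnAr.
by move=> w; rewrite inE => /negbTE /= ->; rewrite mulr0.
Qed.

Lemma mul_deltal a c u v x y : (delta c u v * a) x y = (c * a v y) *+ (x == u).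
Proof.
rewrite cfmM (@fsum_seq _ _ [:: v]) //.
  by rewrite big_seq1 /= eqxx andbT mulrnAl.
by move=> w; rewrite inE => /negbTE /= ->; rewrite andbF mul0r.
Qed.

Lemma diag_subproof T :
  column_finite (fun x y => ((x == y) && `[< T x >])%:R : K).
Proof.
apply/asboolP => y; apply: (@sub_finite_set _ _ [set y]) => // x /=.
by case: (x =P y) => [->|_] /=; rewrite ?eqxx.
Qed.
Definition diag T : cfm K X := CFM (diag_subproof T).

Lemma mul_diagr a T x y : (a * diag T) x y = a x y *+ `[< T y >].
Proof.
rewrite cfmM (@fsum_seq _ _ [:: y]) //.
  by rewrite big_seq1 /= eqxx; case: asboolP => _; rewrite ?mulr1 ?mulr0.
by move=> w; rewrite inE => /negbTE /= ->; rewrite mulr0.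
Qed.

Lemma mul_diagl a T x y : (diag T * a) x y = a x y *+ `[< T x >].
Proof.
rewrite cfmM (@fsum_seq _ _ [:: x]) //.
  by rewrite big_seq1 /= eqxx; case: asboolP => _; rewrite ?mul1r ?mul0r.
by move=> w; rewrite inE eq_sym => /negbTE /= ->; rewrite mul0r.
Qed.
End Matrices.

(** * Levels, blocks and products in [H] *)

Section Levels.
Context {da : Order.disp_t} (aleph : bOrderType da) (K : fieldType).
Context {d : Order.disp_t} (I : porderType d).
Local Notation X := (mindex aleph I).
Local Notation Q := (cfm K X).
Local Notation psi i := (@psi da aleph K d I i).
Local Notation Hi := (@Hi da aleph K d I).
Local Notation H := (@H da aleph K d I).

Lemma seq_finsupp_subproof (s : seq I) (f : I -> aleph) :
  finite_set [set i | (if i \in s then f i else \bot%O) != \bot%O].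
Proof.
apply: (@sub_finite_set _ _ [set` s]); last exact: finite_seq.
by move=> i /=; case: (i \in s); rewrite ?eqxx.
Qed.
Definition seq_finsupp s f := FinSupp (@seq_finsupp_subproof s f).

Lemma mindex_through (p : finsupp aleph I) (C : set I) : total_on C <=%O ->
  exists2 x : X, x.1 = p & C `<=` x.2.
Proof. by move=> /mchain_extends[A CA]; exists (p, A). Qed.

Lemma mindex_through_le (p : finsupp aleph I) (i j : I) : (i <= j)%O ->
  exists x : X, [/\ x.1 = p, (x.2 : set I) i & (x.2 : set I) j].
Proof.
move=> ij; have [|x e h] := @mindex_through p [set i; j].
  by move=> ? ? [->|->] [->|->]; auto.
by exists x; split=> //; apply: h; [left|right].
Qed.

Lemma mindex_through1 (i : I) : exists x : X, (x.2 : set I) i.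
Proof.
have [x [_ xi _]] :=
  mindex_through_le (seq_finsupp [::] (fun=> \bot%O)) (lexx i).
by exists x.
Qed.

Lemma Hi_mulr i j (a : Q) (b : cfm K (mindex aleph (up j))) : (i <= j)%O ->
  ~ maximal_element i -> Hi i a -> Hi i (a * psi j b).
Proof.
move=> ij ni [[_ [c fc ->]]|[/ni//]]; left; split=> //.
have [x xi] := mindex_through1 i; exists (c * block xi (psi j b)).
  exact: finite_rows_mulr.
exact: psi_mulr.
Qed.

Lemma Hi_mull i j (a : Q) (b : cfm K (mindex aleph (up j))) : (i <= j)%O ->
  ~ maximal_element i -> Hi i a -> Hi i (psi j b * a).
Proof.
move=> ij ni [[_ [c fc ->]]|[/ni//]]; left; split=> //.
have [x xi] := mindex_through1 i; exists (block xi (psi j b) * c).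
  exact: finite_rows_mull.
exact: psi_mull.
Qed.

Lemma psi_mul_incomparable i j a b : ~ (i <= j)%O -> ~ (j <= i)%O ->
  psi i a * psi j b = 0.
Proof.
move=> ij ji; apply: cfmP => x y; apply/eqP/negPn/negP => /cfm_mul_neq0[z].
move=> [/psi_fun_neq0[_ zi _ _] /psi_fun_neq0[zj _ _ _]].
by have [totz _] := mchainP z.2; have [] := totz i j zi zj.
Qed.

(** This refines [HiM]: the level of a nonzero product is a lower bound of both levels, which is
    what makes the elements with levels below a given one an ideal. *)
Lemma Hi_mul i j (a b : Q) : Hi i a -> Hi j b -> a * b = 0 \/
  exists k, [/\ (k <= i)%O, (k <= j)%O, k = i \/ k = j & Hi k (a * b)].
Proof.
move=> ha hb; have [a' ea] := Hi_psi ha; have [b' eb] := Hi_psi hb.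
have [ij|ij] := pselect (i <= j)%O.
  right; exists i; split=> //; first by left.
  have [mi|ni] := pselect (maximal_element i).
    by have e := mi j ij; subst j; have [] := HiM ha hb.
  by rewrite eb; exact: Hi_mulr.
have [ji|ji] := pselect (j <= i)%O; last first.
  by left; rewrite ea eb psi_mul_incomparable.
right; exists j; split=> //; first by right.
by rewrite ea; apply: Hi_mull => // mj; apply: ij; rewrite (mj i ji).
Qed.

(** Inside a block an index is determined by its restriction, so a unit column stays a unit column
    under [psi i]. *)
Lemma psi_unit_col i (x : X) (xi : (x.2 : set I) i)
    (r : cfm K (mindex aleph (up i))) :
  (forall u, r u (mindex_restr xi) = (u == mindex_restr xi)%:R) ->
  forall y, psi i r y x = (y == x)%:R.
Proof.
move=> rE y; have [h|h] := pselect (psi_support i y x).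
  have [yi _ _ _] := h; rewrite /= (psi_funE _ yi xi h) rE; congr _%:R.
  congr nat_of_bool; apply/eqP/eqP => [e|e]; last first.
    by subst y; congr mindex_restr; exact: Prop_irrelevance.
  by rewrite -(glue_restr yi xi h) -e glue_restr.
rewrite /= psi_fun_out //; case: eqP => // e; case: h; rewrite e.
by apply: psi_supportE.
Qed.

Lemma psi_unit_row i (x : X) (xi : (x.2 : set I) i)
    (r : cfm K (mindex aleph (up i))) :
  (forall u, r (mindex_restr xi) u = (u == mindex_restr xi)%:R) ->
  forall y, psi i r x y = (y == x)%:R.
Proof.
move=> rE y; have [h|h] := pselect (psi_support i x y).
  have [_ yi _ _] := h; rewrite /= (psi_funE _ xi yi h) rE; congr _%:R.
  congr nat_of_bool; apply/eqP/eqP => [e|e]; last first.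
    by subst y; congr mindex_restr; exact: Prop_irrelevance.
  by rewrite -(glue_restr xi yi h) e glue_restr.
rewrite /= psi_fun_out //; case: eqP => // e; case: h; rewrite e.
by apply: psi_supportE.
Qed.

Lemma Hi_delta i c u v : ~ maximal_element i -> Hi i (psi i (delta c u v)).
Proof.
by left; split=> //; exists (delta c u v); first exact: finite_rows_delta.
Qed.

(** At a maximal level only scalars are available and the identity serves; elsewhere finiteness of
    rows leads to a diagonal matrix unit. *)
Lemma Hi_unit i (v : mindex aleph (up i)) :
  exists c : cfm K (mindex aleph (up i)), Hi i (psi i c) /\
    forall u, c u v = (u == v)%:R.
Proof.
have [mi|ni] := pselect (maximal_element i).
  exists 1; split=> [|u]; last by rewrite cfm1.
  by right; split=> //; exists 1; rewrite scale1r.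
exists (delta 1 v v); split=> [|u]; last by rewrite /= eqxx andbT.
exact: Hi_delta.
Qed.

Lemma Hi_neq0 i : exists2 a : Q, Hi i a & a != 0.
Proof.
have [x xi] := mindex_through1 i.
have [c [hc cE]] := Hi_unit (mindex_restr xi).
exists (psi i c) => //; apply/eqP => /(congr1 (fun q : Q => q x x)).
by rewrite cfm0 (psi_unit_col cE) eqxx; apply/eqP/oner_neq0.
Qed.

Lemma Hi_add i (a b : Q) : Hi i a -> Hi i b -> Hi i (a + b).
Proof.
move=> [[ni [a' fa ->]]|[mi [c ->]]] [[ni' [b' fb ->]]|[mi' [c' ->]]] //.
- left; split=> //; exists (a' + b'); last by rewrite psiD.
  apply: (@sub_finite_set _ _
    ([set x | exists y, a' x y != 0] `|` [set x | exists y, b' x y != 0])).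
    move=> x [y]; have [e|] := eqVneq (a' x y) 0; last by left; exists y.
    by rewrite cfmD e add0r; right; exists y.
  by rewrite finite_setU.
- by right; split=> //; exists (c + c'); rewrite scalerDl.
Qed.

(** Merging the summands of equal level gives one component per level, so that a maximal level with
    nonzero component can be singled out. *)
Lemma H_levels J (q : Q) : H J q -> exists (s : seq I) (f : I -> Q),
  [/\ uniq s, forall i, i \in s -> J i, forall i, Hi i (f i)
    & q = \sum_(i <- s) f i].
Proof.
move=> [t [tJ ->]] {q}; elim: t tJ => [|q t ih] tJ.
  by exists [::], (fun=> 0); split=> // [i|]; rewrite ?big_nil //; exact: Hi0.
have [|s [f [us sJ hf e]]] := ih.
  by move=> r rt; apply: tJ; rewrite inE rt orbT.
have [j Jj hq] := tJ q (mem_head _ _); rewrite big_cons {}e.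
pose g i := if i == j then q + (if j \in s then f j else 0) else f i.
have hg i : Hi i (g i).
  rewrite /g; case: eqP => [->|//]; apply: Hi_add => //.
  by case: ifP => // _; exact: Hi0.
have gE : \sum_(i <- s | i != j) g i = \sum_(i <- s | i != j) f i.
  by apply: eq_bigr => i /negbTE; rewrite /g => ->.
have [js|js] := boolP (j \in s).
  exists s, g; split=> //; rewrite (bigD1_seq j) //= [in RHS](bigD1_seq j) //=.
  by rewrite gE /g eqxx js addrA.
exists (j :: s), g; split=> //=; first by rewrite js.
  by move=> i; rewrite inE => /orP[/eqP ->|/sJ].
rewrite big_cons {1}/g eqxx (negbTE js) addr0; congr (_ + _).
rewrite big_seq [RHS]big_seq; apply: eq_bigr => i is_.
by rewrite /g; case: eqP => // e; rewrite -e is_ in js.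
Qed.

Lemma H_sub (J J' : set I) (q : Q) : J `<=` J' -> H J q -> H J' q.
Proof.
move=> JJ [s [hs ->]]; exists s; split=> // r /hs[j Jj h].
by exists j => //; exact: JJ.
Qed.

(** The quantifier over [J'] allows [q] to be placed in the span of any set containing its levels,
    such as the set above a common lower bound. *)
Lemma H_finite_levels J (q : Q) : H J q -> exists s : seq I,
  (forall i, i \in s -> J i) /\
  forall J' : set I, (forall i, i \in s -> J' i) -> H J' q.
Proof.
move=> /H_levels[s [f [_ sJ hf ->]]]; exists s; split=> // J' sJ'.
by apply: H_sum => i is_; exact: H_Hi (sJ' i is_) (hf i).
Qed.

Lemma H_set1 z (q : Q) : H [set z] q -> Hi z q.
Proof.
move=> [s [hs ->]]; elim: s hs => [|r s ih] hs.
  by rewrite big_nil; exact: Hi0.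
rewrite big_cons; apply: Hi_add; first by have [j ->] := hs r (mem_head _ _).
by apply: ih => t ts; apply: hs; rewrite inE ts orbT.
Qed.

Lemma H_psi_mulr z (x : X) (xz : (x.2 : set I) z) c (q : Q) :
  H [set i | (z <= i)%O] q -> psi z c * q = psi z (c * block xz q).
Proof.
move=> [s [hs ->]]; elim: s hs => [|r s ih] hs.
  rewrite !big_nil; have -> : block xz (0 : Q) = 0 by apply: cfmP.
  by rewrite !mulr0 -[in RHS](scale0r 0) psiZ scale0r.
have -> : block xz (\sum_(t <- r :: s) t) =
    block xz r + block xz (\sum_(t <- s) t).
  by apply: cfmP => u v; rewrite big_cons.
rewrite big_cons !mulrDr psiD ih; last first.
  by move=> t ts; apply: hs; rewrite inE ts orbT.
have [j /= zj /Hi_psi[b ->]] := hs r (mem_head _ _).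
by rewrite (psi_mulr xz).
Qed.

Lemma H_psi_mull z (x : X) (xz : (x.2 : set I) z) c (q : Q) :
  H [set i | (z <= i)%O] q -> q * psi z c = psi z (block xz q * c).
Proof.
move=> [s [hs ->]]; elim: s hs => [|r s ih] hs.
  rewrite !big_nil; have -> : block xz (0 : Q) = 0 by apply: cfmP.
  by rewrite !mul0r -[in RHS](scale0r 0) psiZ scale0r.
have -> : block xz (\sum_(t <- r :: s) t) =
    block xz r + block xz (\sum_(t <- s) t).
  by apply: cfmP => u v; rewrite big_cons.
rewrite big_cons !mulrDl psiD ih; last first.
  by move=> t ts; apply: hs; rewrite inE ts orbT.
have [j /= zj /Hi_psi[b ->]] := hs r (mem_head _ _).
by rewrite (psi_mull xz).
Qed.

Lemma H_uniform z (x y : X) (xz : (x.2 : set I) z) (yz : (y.2 : set I) z)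
    (q : Q) u v : H [set i | (z <= i)%O] q ->
  q (glue xz u) (glue xz v) = q (glue yz u) (glue yz v).
Proof.
move=> [s [hs ->]]; rewrite !cfm_sumE big_seq [RHS]big_seq.
apply: eq_bigr => r /hs[j /= zj /Hi_psi[b ->]].
exact: psi_uniform.
Qed.

Lemma infinite_avoid : infinite_set [set: aleph] ->
  forall F : set aleph, finite_set F -> exists a, ~ F a.
Proof.
move=> inf F fF; apply: contrapT => /forallNP h; apply: inf.
by apply: sub_finite_set fF => a _; exact: contrapT (h a).
Qed.

(* Among the levels [i] with [f i != 0] take a maximal one.  The entries of
   [f i] repeat in every block of level [i], and a block can be chosen by its
   values at the finitely many levels [j < i] so as to avoid the finitely many
   nonzero rows of each of these [f j]. *)
Lemma H_neq0_block (inf : infinite_set [set: aleph]) z (q : Q) :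
  H [set i | (z <= i)%O] q -> q != 0 ->
  forall (x : X) (xz : (x.2 : set I) z),
  exists u v, q (glue xz u) (glue xz v) != 0.
Proof.
move=> Hq q0 x xz; have [s [f [us sz hf eq]]] := H_levels Hq.
have [i0 i0s f0] : exists2 i, i \in s & f i != 0.
  apply: contrapT => /forall2NP h; case/eqP: q0; rewrite eq big_seq.
  by apply: big1 => i is_; apply/eqP; have [|/negP/negPn] := h i.
have [|i] := @seq_maximal _ _ [seq i <- s | f i != 0] i0.
  by rewrite mem_filter f0.
rewrite mem_filter => /andP[fi is_] imax.
have [b fb] : exists b : forall j, cfm K (mindex aleph (up j)),
    forall j, f j = psi j (b j) /\ (~ maximal_element j -> finite_rows (b j)).
  have h j : exists b, f j = psi j b /\ (~ maximal_element j -> finite_rows b).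
    case: (hf j) => [[nj [b Fb ->]]|[mj _]]; first by exists b.
    by have [b ->] := Hi_psi (hf j); exists b.
  by exists (fun j => projT1 (cid (h j))) => j; case: cid.
have [p hp] : exists p : I -> aleph, forall j, ~ maximal_element j ->
    forall r : mindex aleph (up j), (exists t, b j r t != 0) ->
    r.1 (Up (lexx j)) <> p j.
  have [j|p hp] := @choice I aleph (fun j y => ~ maximal_element j ->
    forall r : mindex aleph (up j), (exists t, b j r t != 0) ->
    r.1 (Up (lexx j)) <> y); last by exists p.
  have [mj|nj] := pselect (maximal_element j); first by exists \bot%O.
  have [|y hy] := infinite_avoid inf (F := (fun r : mindex aleph (up j) =>
      r.1 (Up (lexx j))) @` [set r | exists t, b j r t != 0]).
    by apply: finite_image; exact: (fb j).2 nj.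
  by exists y => _ r hr e; apply: hy; exists r.
have zi : (z <= i)%O by exact: sz.
have [x' [x'p x'z x'i]] := mindex_through_le (seq_finsupp s p) zi.
have [u0 [v0 buv]] : exists u v, b i u v != 0.
  apply: contrapT => h; case/eqP: fi; rewrite (fb i).1.
  have -> : b i = 0.
    apply: cfmP => u v; apply/eqP/negPn/negP => n; apply: h; by exists u, v.
  by rewrite -[X in psi i X](scale0r 0) psiZ scale0r.
pose u := glue x'i u0; pose v := glue x'i v0.
have uvz : psi_support z u v.
  apply: (psi_support_le zi); first by apply/glue_mem_le.
  exact: psi_support_glue2.
have quv : q u v = b i u0 v0.
  rewrite eq cfm_sumE (bigD1_seq i) //= (fb i).1.
  rewrite [X in X + _]psi_fun_glue big_seq_cond big1 ?addr0 //.
  (* Another level [j] contributing to this entry shares a chain with [i]. Above [i] it contradicts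
     maximality. Below [i], the coordinate [j] is untouched by [glue], so [u] has there the value
     [p j], which no nonzero row of [b j] has. *)
  move=> j /andP[js ji]; rewrite (fb j).1.
  apply/eqP/negPn/negP => n.
  have supp := psi_fun_neq0 n; have [uj vj _ _] := supp.
  have ui : (u.2 : set I) i by exact: glue_base.
  have [totu _] := mchainP u.2; have [ij|lji] := totu i j ui uj.
    have [|fj0] := eqVneq (f j) 0.
      by move=> e; move: n; rewrite -(fb j).1 e cfm0 eqxx.
    by case/eqP: ji; apply: imax => //; rewrite mem_filter fj0.
  have nj : ~ maximal_element j by move=> /(_ i lji) e; rewrite e eqxx in ji.
  move: n; rewrite /= (psi_funE _ uj vj supp) => n.
  apply: (hp j nj (mindex_restr uj)); first by exists (mindex_restr vj).
  rewrite -[LHS]/(u.1 j) glue_val_out ?x'p /= ?js //.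
  by move=> ij; case/eqP: ji; apply/le_anti; rewrite lji ij.
have [uz vz _ _] := uvz.
(* The chosen block of level [i] lies in a block of level [z], and the entries of [q] there repeat
   in the block of the given [x]. *)
exists (mindex_restr uz), (mindex_restr vz).
rewrite (H_uniform xz x'z) //.
have base w (wz : ((glue x'i w).2 : set I) z) :
    glue x'z (mindex_restr wz) = glue x'i w.
  apply: glue_restr; apply: (psi_support_le zi) => //.
  exact: psi_support_glue.
by rewrite !base -/u -/v quv.
Qed.
(** A matrix unit scaled by the inverse of the entry carries row [y] to row [x] and kills the other
    rows. This yields simplicity of the module of columns at [x]. *)
Lemma H_cancel_col z (x y : X) (q : Q) : H [set i | (z <= i)%O] q ->
  ~ maximal_element z -> psi_support z x y -> q y x != 0 ->
  exists2 r, Hi z r & forall w, (r * q) w x = (w == x)%:R.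
Proof.
move=> Hq nz h qyx; have [xz yz _ _] := h.
exists (psi z (delta (q y x)^-1 (mindex_restr xz) (mindex_restr yz))).
  exact: Hi_delta.
rewrite (H_psi_mulr xz) //; apply: psi_unit_col => u.
by rewrite mul_deltal /= !glue_restr ?mulVf //; exact: psi_supportE.
Qed.

Lemma H_cancel_row z (x y : X) (q : Q) : H [set i | (z <= i)%O] q ->
  ~ maximal_element z -> psi_support z x y -> q x y != 0 ->
  exists2 r, Hi z r & forall w, (q * r) x w = (w == x)%:R.
Proof.
move=> Hq nz h qxy; have [xz yz _ _] := h.
exists (psi z (delta (q x y)^-1 (mindex_restr yz) (mindex_restr xz))).
  exact: Hi_delta.
rewrite (H_psi_mull xz) //; apply: psi_unit_row => u.
by rewrite mul_deltar /= !glue_restr ?mulfV //; exact: psi_supportE.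
Qed.

(** The block of [x] contains a nonzero entry of [q], possibly in another column; right
    multiplication by a matrix unit moves that column to [x]. *)
Lemma H_faithful_col (inf : infinite_set [set: aleph]) z (x : X) (q : Q) :
  H [set i | (z <= i)%O] q -> ~ maximal_element z -> (x.2 : set I) z ->
  q != 0 -> exists2 r, Hi z r & exists w, (q * r) w x != 0.
Proof.
move=> Hq nz xz q0; have [u [v quv]] := H_neq0_block inf Hq q0 xz.
have [c xE] : exists c, glue xz c = x.
  by exists (mindex_restr xz); apply: glue_restr; exact: psi_supportE.
exists (psi z (delta 1 v c)); first exact: Hi_delta.
exists (glue xz u); rewrite (H_psi_mull xz) //.
have := psi_fun_glue (block xz q * delta 1 v c) xz u c.
by rewrite xE mul_deltar eqxx mulr1 /= => ->.
Qed.

Lemma H_faithful_row (inf : infinite_set [set: aleph]) z (x : X) (q : Q) :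
  H [set i | (z <= i)%O] q -> ~ maximal_element z -> (x.2 : set I) z ->
  q != 0 -> exists2 r, Hi z r & exists w, (r * q) x w != 0.
Proof.
move=> Hq nz xz q0; have [u [v quv]] := H_neq0_block inf Hq q0 xz.
have [c xE] : exists c, glue xz c = x.
  by exists (mindex_restr xz); apply: glue_restr; exact: psi_supportE.
exists (psi z (delta 1 c u)); first exact: Hi_delta.
exists (glue xz v); rewrite (H_psi_mulr xz) //.
have := psi_fun_glue (delta 1 c u * block xz q) xz c v.
by rewrite xE mul_deltal eqxx mul1r /= => ->.
Qed.

Lemma H_sandwich_neq0 (inf : infinite_set [set: aleph]) z (p q : Q) :
  H [set i | (z <= i)%O] p -> H [set i | (z <= i)%O] q ->
  ~ maximal_element z -> p != 0 -> q != 0 ->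
  exists2 r, Hi z r & p * r * q != 0.
Proof.
move=> Hp Hq nz p0 q0; have [x xz] := mindex_through1 z.
have [u [v puv]] := H_neq0_block inf Hp p0 xz.
have [u' [v' quv]] := H_neq0_block inf Hq q0 xz.
(* This matrix unit joins column [v] of [p] to row [u'] of [q], so the product of the two nonzero
   entries appears as an entry of [p * r * q]. *)
exists (psi z (delta 1 v u')); first exact: Hi_delta.
apply/eqP => /(congr1 (fun q : Q => q (glue xz u) (glue xz v'))).
rewrite cfm0 -mulrA (H_psi_mulr xz) // (H_psi_mull xz) //.
rewrite [LHS]psi_fun_glue cfmM (@fsum_seq _ _ [:: v]) //.
  rewrite big_seq1 mul_deltal eqxx mul1r => /eqP; apply/negP.
  by rewrite mulf_eq0 negb_or puv.
by move=> w; rewrite inE mul_deltal => /negbTE ->; rewrite mulr0.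
Qed.

Lemma H_entry_chain J (q : Q) x y : H J q -> q x y != 0 ->
  exists2 j, J j & psi_support j x y.
Proof.
move=> [s [hs ->]]; rewrite cfm_sumE => h; apply: contrapT => n.
case/eqP: h; rewrite big_seq big1 // => r /hs[j Jj /Hi_psi[b ->]].
by apply: psi_fun_out => hj; apply: n; exists j.
Qed.

(** * Projections onto the indices whose chain meets a finite set *)

Definition meeting (P : porderType d) (s : seq P) : set (mindex aleph P) :=
  [set x : mindex aleph P | exists2 i, i \in s & (x.2 : set P) i].

Definition above j (s : seq I) : seq (up j) := pmap insub s.

Lemma meeting_restr j (s : seq I) (x : X) (xj : (x.2 : set I) j) :
  (forall i, i \in s -> (j <= i)%O) ->
  meeting s x <-> meeting (above j s) (mindex_restr xj).
Proof.
move=> js; split=> [[i is_ xi]|[k ks xk]].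
  exists (Up (js i is_)) => //; rewrite mem_pmap; apply/mapP; exists i => //.
  case: insubP => [k _ e|/negP[]]; last exact: js.
  by rewrite [k](_ : _ = Up (js i is_)) //; exact: val_inj.
exists (up_val k) => //; move: ks; rewrite mem_pmap => /mapP[i is_].
by case: insubP => // k' _ e [->]; rewrite -e in is_.
Qed.

(** As [s] lies above [j], whether a chain through [j] meets [s] depends only on its part above [j],
    so the projection acts inside the blocks of level [j]. *)
Lemma psi_meetingr j (s : seq I) a : (forall i, i \in s -> (j <= i)%O) ->
  psi j a * diag K (meeting s) = psi j (a * diag K (meeting (above j s))).
Proof.
move=> js; apply: cfmP => x y; rewrite mul_diagr.
have [h|h] := pselect (psi_support j x y); last first.
  by rewrite /= !psi_fun_out ?mul0rn.
have [xj yj _ _] := h; rewrite /= !(psi_funE _ xj yj h) mul_diagr.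
by congr (_ *+ nat_of_bool _); apply/asbool_equiv_eq/meeting_restr.
Qed.

Lemma psi_meetingl j (s : seq I) a : (forall i, i \in s -> (j <= i)%O) ->
  diag K (meeting s) * psi j a = psi j (diag K (meeting (above j s)) * a).
Proof.
move=> js; apply: cfmP => x y; rewrite mul_diagl.
have [h|h] := pselect (psi_support j x y); last first.
  by rewrite /= !psi_fun_out ?mul0rn.
have [xj yj _ _] := h; rewrite /= !(psi_funE _ xj yj h) mul_diagl.
by congr (_ *+ nat_of_bool _); apply/asbool_equiv_eq/meeting_restr.
Qed.

(** All members of [s] equal the maximal [j], so at this level the projection is 0 or 1 and
    preserves scalars. *)
Lemma meeting_maximal j (s : seq I) (u : mindex aleph (up j)) :
  maximal_element j -> (forall i, i \in s -> (j <= i)%O) ->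
  meeting (above j s) u <-> s != [::].
Proof.
move=> mj js; have [x xj] := mindex_through1 j.
rewrite -{1}(restr_glue (glue_base xj u)); rewrite -meeting_restr //.
split=> [[i]|]; first by case: (s).
case: s js => // i s js _; exists i; first exact: mem_head.
by rewrite (mj i (js i (mem_head _ _))); exact: glue_base.
Qed.

(** The projection itself need not lie in [H], but multiplying by it does not leave a level below
    [s]. *)
Lemma Hi_meetingr j (s : seq I) (q : Q) : (forall i, i \in s -> (j <= i)%O) ->
  Hi j q -> Hi j (q * diag K (meeting s)).
Proof.
move=> js [[nj [a fa ->]]|[mj [c ->]]]; rewrite -?psiZ psi_meetingr //.
  left; split=> //; exists (a * diag K (meeting (above j s))) => //.
  exact: finite_rows_mulr.
right; split=> //; exists (c *+ (s != [::])); rewrite -psiZ; congr (psi j _).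
apply: cfmP => u v; rewrite mul_diagr !cfmZ mulrnAl.
by congr (_ *+ nat_of_bool _); apply/asboolP/idP => /(meeting_maximal _ mj js).
Qed.

Lemma Hi_meetingl j (s : seq I) (q : Q) : (forall i, i \in s -> (j <= i)%O) ->
  Hi j q -> Hi j (diag K (meeting s) * q).
Proof.
move=> js [[nj [a fa ->]]|[mj [c ->]]]; rewrite -?psiZ psi_meetingl //.
  left; split=> //; exists (diag K (meeting (above j s)) * a) => //.
  exact: finite_rows_mull.
right; split=> //; exists (c *+ (s != [::])); rewrite -psiZ; congr (psi j _).
apply: cfmP => u v; rewrite mul_diagl !cfmZ mulrnAl.
by congr (_ *+ nat_of_bool _); apply/asboolP/idP => /(meeting_maximal _ mj js).
Qed.
End Levels.

(** * Primeness of the ring, and its primitivity from a coinitial chain *)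

Section Ring.
Import functions.
Context {da : Order.disp_t} (aleph : bOrderType da) (K : fieldType).
Context {d : Order.disp_t} (I : porderType d) (J : set I).
Context (hI : has_finite_cofinal I) (hJ : upper_subset J).
Local Notation X := (mindex aleph I).
Local Notation Q := (cfm K X).
Local Notation Hi := (@Hi da aleph K d I).
Local Notation H := (@H da aleph K d I).
Local Notation HR := (H_ring aleph K hI hJ).

Definition to_H q (h : H J q) : HR := HRing hI hJ (asboolT h).

Lemma Hi_elt j q : J j -> Hi j q -> exists a : HR, H_val a = q.
Proof. by move=> Jj hq; exists (to_H (H_Hi Jj hq)). Qed.

Lemma H_val0 (a : HR) : H_val a = 0 -> a = 0.
Proof. by move=> e; apply: val_inj. Qed.

Lemma H_valM (a b : HR) : H_val (a * b) = H_val a * H_val b.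
Proof. by []. Qed.

Lemma mul_unit_col (a e : Q) (x : X) : (forall y, e y x = (y == x)%:R) ->
  forall y, (a * e) y x = a y x.
Proof.
move=> eE y; rewrite cfmM (@fsum_seq _ _ [:: x]) //.
  by rewrite big_seq1 eE eqxx mulr1.
by move=> w; rewrite inE eE => /negbTE ->; rewrite mulr0.
Qed.

(** The identity of the ring is known only by its defining property; multiplying it by an element
    with a unit column at [x] reveals its own column at [x]. *)
Lemma H_one_col (x : X) j : J j -> (x.2 : set I) j ->
  forall y, H_val (1 : HR) y x = (y == x)%:R.
Proof.
move=> Jj xj y; have [c [/(Hi_elt Jj)[e ev] cE]] := Hi_unit K (mindex_restr xj).
have eE w : H_val e w x = (w == x)%:R by rewrite ev; exact: psi_unit_col.
by rewrite -eE -[in RHS](mul1r e) H_valM mul_unit_col.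
Qed.

Lemma H_one_row (x : X) j : J j -> (x.2 : set I) j ->
  forall y, H_val (1 : HR) x y = (y == x)%:R.
Proof.
move=> Jj xj y.
have [[i Ji yi]|ny] := pselect (exists2 i, J i & (y.2 : set I) i).
  by rewrite (H_one_col Ji yi) eq_sym.
have [->|/(H_entry_chain (H_valP (1 : HR)))[i Ji [_ yi _ _]]] :=
  eqVneq (H_val (1 : HR) x y) 0; last by case: ny; exists i.
by case: eqP => // yx; case: ny; exists j; rewrite ?yx.
Qed.

Lemma H_nontrivial j : J j -> (1 : HR) != 0.
Proof.
move=> Jj; have [x xj] := mindex_through1 aleph j; apply/eqP => e.
have := H_one_col Jj xj x; rewrite e cfm0 eqxx => /esym/eqP.
by rewrite oner_eq0.
Qed.

Lemma prime_directed : prime_ring HR -> downward_directed J.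
Proof.
move=> [n0 prim]; split.
  apply: contrapT => nJ; case/eqP: n0; apply: H_val0.
  have [[|r s] [hs ->]] := H_valP (1 : HR); first by rewrite big_nil.
  by have [j Jj] := hs r (mem_head _ _); case: nJ; exists j.
move=> i j Ji Jj; apply: contrapT => nz.
have [a' /[dup]/Hi_psi[p pE] /(Hi_elt Ji)[a aE] a0] := @Hi_neq0 _ aleph K _ _ i.
have [b' /[dup]/Hi_psi[q qE] /(Hi_elt Jj)[b bE] b0] := @Hi_neq0 _ aleph K _ _ j.
have [r|ea|eb] := prim a b; last 2 first.
- by move: a0; rewrite -aE ea eqxx.
- by move: b0; rewrite -bE eb eqxx.
apply: H_val0; apply: cfmP => x y; rewrite cfm0 !H_valM aE bE pE qE.
(* A nonzero entry of [a * r * b] passes through an index [s] whose chain contains [i] and an index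
   [t] whose chain contains [j]. A level [k] of [r] lies on both chains, which agree below [k];
   comparing [i], [j] and [k] on them gives a common lower bound in [J]. *)
apply/eqP/negPn/negP => /cfm_mul_neq0[t [/cfm_mul_neq0[s [n1 n2]] n3]].
have [_ si _ _] := psi_fun_neq0 n1; have [tj _ _ _] := psi_fun_neq0 n3.
have [k Jk hk] := H_entry_chain (H_valP r) n2; have [sk tk _ _] := hk.
have [tots _] := mchainP s.2; have [tott _] := mchainP t.2.
have [ik|ki] := tots i k si sk.
  have ti : (t.2 : set I) i by apply/(psi_support_in hk ik).
  by have [ij|ji] := tott i j ti tj; apply: nz; [exists i|exists j].
by have [jk|kj] := tott j k tj tk; apply: nz; [exists j|exists k];
  split=> //; exact: le_trans ki.
Qed.

Lemma directed_prime (inf : infinite_set [set: aleph]) n :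
  J n -> ~ maximal_element n -> downward_directed J -> prime_ring HR.
Proof.
move=> Jn nn dirJ; split; first exact: H_nontrivial Jn.
move=> a b ab; have [|a0] := eqVneq a 0; first by left.
have [|b0] := eqVneq b 0; first by right.
have [s [sJ hs]] := H_finite_levels (H_valP a).
have [t [tJ ht]] := H_finite_levels (H_valP b).
(* Including the nonmaximal [n] forces [z] to be nonmaximal, so that level [z] contains matrix
   units. *)
have [i|z Jz hz] := directed_lower_bound (s := n :: s ++ t) dirJ.
  by rewrite inE mem_cat => /or3P[/eqP ->|/sJ|/tJ].
have nz : ~ maximal_element z.
  by move=> mz; apply: nn; rewrite (mz n) // hz // mem_head.
have [|||||_ /(Hi_elt Jz)[r <-]] := @H_sandwich_neq0 _ aleph K _ _ inf z
  (H_val a) (H_val b).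
- by apply: hs => i is_; apply: hz; rewrite inE mem_cat is_ orbT.
- by apply: ht => i it; apply: hz; rewrite inE mem_cat it !orbT.
- exact: nz.
- by apply: contraNN a0 => /eqP/H_val0 ->.
- by apply: contraNN b0 => /eqP/H_val0 ->.
- by rewrite -!H_valM ab eqxx.
Qed.

Section CoinitialChain.
Context (inf : infinite_set [set: aleph]) (n : I) (Jn : J n).
Context (nn : ~ maximal_element n).
Context (C : set I) (C0 : C !=set0) (CJ : C `<=` J) (totC : total_on C <=%O).
Context (cofC : forall j, J j -> exists2 c, C c & (c <= j)%O).

(** Taking [z] in [C] puts it on the fixed maximal chain of the index [x] used below; adding [n] to
    the levels of [a] keeps [z] nonmaximal. *)
Lemma chain_level (a : HR) : exists z, [/\ C z, J z, ~ maximal_element z &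
  H [set i | (z <= i)%O] (H_val a)].
Proof.
have [s [sJ hs]] := H_finite_levels (H_valP a).
have [i|z Cz hz] := coinitial_lower_bound (s := n :: s) C0 CJ totC cofC.
  by rewrite inE => /orP[/eqP ->|/sJ].
exists z; split=> //; first exact: CJ.
  by move=> mz; apply: nn; rewrite (mz n) // hz // mem_head.
by apply: hs => i is_; apply: hz; rewrite inE is_ orbT.
Qed.

Lemma coinitial_left_primitive : left_primitive HR.
Proof.
have [x _ Cx] := mindex_through (seq_finsupp (aleph := aleph) [::]
  (fun=> \bot%O)) totC.
pose phi (a : HR) (y : X) : K := H_val a y x.
have [z0 [Cz0 Jz0 _ _]] := chain_level 0.
have one y : phi 1 y = (y == x)%:R by apply: (H_one_col Jz0); exact: Cx.
apply: (left_primitive_orbit (phi := phi)).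
- by [].
- move=> r a h; apply/funext => y; rewrite /phi H_valM; apply: fsbig1 => w _.
  by rewrite -[H_val a w x]/(phi a w) h mulr0.
- apply/eqP => /(congr1 (fun f => f x)); rewrite one eqxx => /eqP.
  by rewrite oner_eq0.
- move=> a a0; have [z [Cz Jz nz Ha]] := chain_level a.
  have [y yx] : exists y, H_val a y x != 0.
    apply: contrapT => h; case/eqP: a0; apply/funext => y.
    by apply/eqP/negPn/negP => yx; apply: h; exists y.
  (* The nonzero entry puts [y] in the block of [x] at some level above [z], hence also at level
     [z], since [z] is on the chain of [x]. *)
  have [i /= zi /psi_support_sym xy] := H_entry_chain Ha yx.
  have [_ /(Hi_elt Jz)[r <-] hr] := H_cancel_col Ha nz
    (psi_support_le zi (Cx z Cz) xy) yx.
  by exists r; apply/funext => w; rewrite one /phi H_valM hr.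
- move=> a a0; have [z [Cz Jz nz Ha]] := chain_level a.
  have [|_ /(Hi_elt Jz)[r <-] [w hw]] := H_faithful_col inf Ha nz (Cx z Cz).
    by apply: contraNN a0 => /eqP/H_val0 ->.
  by exists r; apply: contraNN hw => /eqP/(congr1 (fun f => f w)) e; apply/eqP.
Qed.

Lemma coinitial_right_primitive : right_primitive HR.
Proof.
have [x _ Cx] := mindex_through (seq_finsupp (aleph := aleph) [::]
  (fun=> \bot%O)) totC.
pose phi (a : HR) (y : X) : K := H_val a x y.
have [z0 [Cz0 Jz0 _ _]] := chain_level 0.
have one y : phi 1 y = (y == x)%:R by apply: (H_one_row Jz0); exact: Cx.
apply: (@left_primitive_orbit HR^c _ phi).
- by [].
- move=> r a h; apply/funext => y; rewrite /phi H_valM; apply: fsbig1 => w _.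
  by rewrite -[H_val a x w]/(phi a w) h mul0r.
- apply/eqP => /(congr1 (fun f => f x)); rewrite one eqxx => /eqP.
  by rewrite oner_eq0.
- move=> a a0; have [z [Cz Jz nz Ha]] := chain_level a.
  have [y xy] : exists y, H_val a x y != 0.
    apply: contrapT => h; case/eqP: a0; apply/funext => y.
    by apply/eqP/negPn/negP => xy; apply: h; exists y.
  have [i /= zi hxy] := H_entry_chain Ha xy.
  have [_ /(Hi_elt Jz)[r <-] hr] := H_cancel_row Ha nz
    (psi_support_le zi (Cx z Cz) hxy) xy.
  by exists r; apply/funext => w; rewrite one /phi H_valM hr.
- move=> a a0; have [z [Cz Jz nz Ha]] := chain_level a.
  have [|_ /(Hi_elt Jz)[r <-] [w hw]] := H_faithful_row inf Ha nz (Cx z Cz).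
    by apply: contraNN a0 => /eqP/H_val0 ->.
  by exists r; apply: contraNN hw => /eqP/(congr1 (fun f => f w)) e; apply/eqP.
Qed.
End CoinitialChain.
End Ring.

(** * The case of a single maximal level *)

Section Primitive.

Lemma division_left_primitive (R : pzRingType) : (1 : R) != 0 ->
  (forall a : R, a != 0 -> exists b, b * a = 1) -> left_primitive R.
Proof.
move=> n0 inv; apply: (@left_primitive_orbit R R id) => //.
  by move=> r a ->; rewrite mulr0.
by move=> a a0; exists 1; rewrite mulr1.
Qed.

Context {da : Order.disp_t} (aleph : bOrderType da) (K : fieldType).
Context {d : Order.disp_t} (I : porderType d) (J : set I).
Context (hI : has_finite_cofinal I) (hJ : upper_subset J).
Local Notation X := (mindex aleph I).
Local Notation Q := (cfm K X).
Local Notation psi i := (@psi da aleph K d I i).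
Local Notation Hi := (@Hi da aleph K d I).
Local Notation H := (@H da aleph K d I).
Local Notation HR := (H_ring aleph K hI hJ).

Lemma psi1_mul z (c e : K) :
  (c *: psi z 1) * (e *: psi z 1) = (c * e) *: psi z 1.
Proof.
have [x xz] := mindex_through1 aleph z.
rewrite -!psiZ (psi_mulr xz) // block_psi; congr (psi z _).
apply: cfmP => u v; rewrite cfmM (@fsum_seq _ _ [:: u]) //.
  by rewrite big_seq1 !cfmZ !cfm1 eqxx mulr1 mulrA.
by move=> w; rewrite inE eq_sym => /negbTE h; rewrite cfmZ cfm1 h mulr0 mul0r.
Qed.

(** Here every element is a scalar multiple of [psi z 1], and the ring is a copy of [K]. *)
Lemma H_maximal_invertible z (a : HR) : maximal_element z -> J = [set z] ->
  a != 0 -> exists b, b * a = 1 /\ a * b = 1.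
Proof.
move=> mz Jz a0; have Jz' : J z by rewrite Jz.
have scal (r : HR) : exists c : K, H_val r = c *: psi z 1.
  have : Hi z (H_val r) by apply: H_set1; rewrite -Jz; exact: H_valP.
  by case=> [[nz _]|[_ //]]; case: nz.
have elt c : exists r : HR, H_val r = c *: psi z 1.
  by apply: (Hi_elt hI hJ Jz'); right; split=> //; exists c.
have [e eE] := elt 1; have [c aE] := scal a; have [b bE] := elt c^-1.
have [c1 oneE] := scal 1.
have e1 : e = 1.
  apply: val_inj; rewrite -[e]mulr1; apply: etrans (esym oneE).
  by rewrite [LHS](H_valM _ _) eE oneE psi1_mul mul1r.
have c0 : c != 0.
  by apply: contraNN a0 => /eqP c0; apply/eqP/H_val0; rewrite aE c0 scale0r.
by exists b; rewrite -e1; split; apply: val_inj;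
  rewrite [LHS](H_valM _ _) [RHS]eE aE bE psi1_mul
  ?mulVf ?mulfV.
Qed.

Lemma H_maximal_left_primitive z : maximal_element z -> J = [set z] ->
  left_primitive HR.
Proof.
move=> mz Jz; have Jz' : J z by rewrite Jz.
apply: division_left_primitive; first exact: H_nontrivial Jz'.
by move=> a a0; have [b []] := H_maximal_invertible mz Jz a0; exists b.
Qed.

Lemma H_maximal_right_primitive z : maximal_element z -> J = [set z] ->
  right_primitive HR.
Proof.
move=> mz Jz; have Jz' : J z by rewrite Jz.
apply: division_left_primitive; first exact: H_nontrivial Jz'.
by move=> a a0; have [b []] := H_maximal_invertible mz Jz a0; exists b.
Qed.

(** * From a faithful simple module to a coinitial chain *)

Definition H_below k : set HR :=
  [set a | H (J `&` [set j | (j <= k)%O]) (H_val a)].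

Lemma H_below0 k : H_below k 0.
Proof. by exists [::]; rewrite big_nil. Qed.

Lemma H_belowM k (r a : HR) :
  H_below k a -> H_below k (r * a) /\ H_below k (a * r).
Proof.
move=> [s [hs aE]]; have [t [ht rE]] := H_valP r; split.
  change (H (J `&` [set j | (j <= k)%O]) (H_val r * H_val a)).
  rewrite aE rE mulr_suml; apply: H_sum => p /ht[i Ji hp].
  rewrite mulr_sumr; apply: H_sum => q /hs[j [Jj /= jk] hq].
  have [->|[l [_ lj lij hl]]] := Hi_mul hp hq; first exact: (H_below0 k).
  by apply: H_Hi hl; split; [case: lij => ->|exact: le_trans jk].
change (H (J `&` [set j | (j <= k)%O]) (H_val a * H_val r)).
rewrite aE rE mulr_suml; apply: H_sum => q /hs[j [Jj /= jk] hq].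
rewrite mulr_sumr; apply: H_sum => p /ht[i Ji hp].
have [->|[l [lj _ lij hl]]] := Hi_mul hq hp; first exact: (H_below0 k).
by apply: H_Hi hl; split; [case: lij => ->|exact: le_trans jk].
Qed.

Lemma H_below_neq0 k : J k -> exists2 a, H_below k a & a != 0.
Proof.
move=> Jk; have [q hq q0] := @Hi_neq0 _ aleph K _ _ k.
have [a aE] := Hi_elt hI hJ Jk hq; exists a.
  by rewrite /H_below /= aE; apply: H_Hi hq; split=> /=.
by apply: contraNN q0 => /eqP a0; rewrite -aE a0.
Qed.

Lemma H_below_meeting k (s : seq I) (a : HR) :
  (forall i, i \in s -> (k <= i)%O) ->
  H_below k a ->
  (exists2 c, H_below k c & H_val c = H_val a * diag K (meeting s)) /\
  (exists2 c, H_below k c & H_val c = diag K (meeting s) * H_val a).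
Proof.
move=> ks [t [ht aE]].
have sub q : H (J `&` [set j | (j <= k)%O]) q ->
    exists2 c, H_below k c & H_val c = q.
  move=> hq; have hq' : H J q by apply: H_sub hq => j [].
  by exists (to_H hI hJ hq').
have le j i : (j <= k)%O -> i \in s -> (j <= i)%O.
  by move=> jk /ks; exact: le_trans.
split; apply: sub; rewrite aE ?mulr_suml ?mulr_sumr; apply: H_sum => q;
  move=> /ht[j [Jj /= jk] hq]; apply: (@H_Hi _ _ _ _ _ _ j) => //.
  by apply: Hi_meetingr => // i; exact: le.
by apply: Hi_meetingl => // i; exact: le.
Qed.

Section FiniteIntersection.
Context (b : I -> HR) (S : I -> seq I) (z : I).
Hypothesis bS : forall k, J k -> H [set` S k] (H_val (b k)).
Context (L : set HR).
Hypothesis LD : forall a c, L a -> L c -> L (a + c).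
Hypothesis Lb : forall k, J k -> L (1 - b k).

(* The columns of [b k] at the indices missing [S k] vanish, so the part of [c]
   supported on these columns is unchanged by multiplication by [1 - b k]. *)
Lemma left_ideal_meeting (s : seq I) :
  J z -> (forall r a, L a -> L (r * a)) ->
  (forall k, k \in s -> J k) ->
  (forall k i, k \in s -> i \in S k -> (z <= i)%O) ->
  forall c, H_below z c ->
  (forall x y, H_val c x y != 0 -> exists2 k, k \in s & ~ meeting (S k) y) ->
  L c.
Proof.
move=> Jz LM; elim: s => [|k s ih] sJ sz c cz hc.
  (* With no [k] left, [c] has no nonzero entry; zero is written as a multiple of an element of
     [L]. *)
  suff -> : c = 0 * (1 - b z) by apply: LM; exact: Lb.
  rewrite mul0r; apply: H_val0; apply: cfmP => x y; apply/eqP/negPn/negP.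
  by move=> /hc[].
have [[c' c'z c'E] _] := H_below_meeting (sz k ^~ (mem_head _ _)) cz.
have ks := mem_head k s.
have -> : c = c' + (c - c') * (1 - b k).
  rewrite mulrBr mulr1.
  suff -> : (c - c') * b k = 0 by rewrite subr0 addrC subrK.
  apply: H_val0; apply: cfmP => x y; rewrite cfm0 H_valM.
  apply/eqP/negPn/negP => /cfm_mul_neq0[w [n1 /(H_entry_chain (bS (sJ _ ks)))]].
  move=> [i /= iS [wi _ _ _]]; move/eqP: n1; apply.
  rewrite -[LHS]/(H_val c x w - H_val c' x w) c'E mul_diagr asboolT ?subrr //.
  by exists i.
apply: LD; last by apply: LM; apply: Lb; exact: sJ.
apply: ih => // [l ls|l i ls|x y].
- by apply: sJ; rewrite inE ls orbT.
- by apply: sz; rewrite inE ls orbT.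
rewrite c'E mul_diagr; case: asboolP => [my cxy|]; last by rewrite eqxx.
have [l] := hc x y cxy; rewrite inE => /orP[/eqP -> //|ls nl].
by exists l.
Qed.

Lemma right_ideal_meeting (s : seq I) :
  J z -> (forall r a, L a -> L (a * r)) ->
  (forall k, k \in s -> J k) ->
  (forall k i, k \in s -> i \in S k -> (z <= i)%O) ->
  forall c, H_below z c ->
  (forall x y, H_val c x y != 0 -> exists2 k, k \in s & ~ meeting (S k) x) ->
  L c.
Proof.
move=> Jz LM; elim: s => [|k s ih] sJ sz c cz hc.
  suff -> : c = (1 - b z) * 0 by apply: LM; exact: Lb.
  rewrite mulr0; apply: H_val0; apply: cfmP => x y; apply/eqP/negPn/negP.
  by move=> /hc[].
have [_ [c' c'z c'E]] := H_below_meeting (sz k ^~ (mem_head _ _)) cz.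
have ks := mem_head k s.
have -> : c = c' + (1 - b k) * (c - c').
  rewrite mulrBl mul1r.
  suff -> : b k * (c - c') = 0 by rewrite subr0 addrC subrK.
  apply: H_val0; apply: cfmP => x y; rewrite cfm0 H_valM.
  apply/eqP/negPn/negP => /cfm_mul_neq0[w [+ n1]].
  move=> /(H_entry_chain (bS (sJ _ ks))).
  move=> [i /= iS [_ wi _ _]]; move/eqP: n1; apply.
  rewrite -[LHS]/(H_val c w y - H_val c' w y) c'E mul_diagl asboolT ?subrr //.
  by exists i.
apply: LD; last by apply: LM; apply: Lb; exact: sJ.
apply: ih => // [l ls|l i ls|x y].
- by apply: sJ; rewrite inE ls orbT.
- by apply: sz; rewrite inE ls orbT.
rewrite c'E mul_diagl; case: asboolP => [my cxy|]; last by rewrite eqxx.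
have [l] := hc x y cxy; rewrite inE => /orP[/eqP -> //|ls nl].
by exists l.
Qed.
End FiniteIntersection.

(** This is the part common to both sides. If no chain met all of finitely many [S k], the last
    hypothesis would put [b z] in [L] for a [z] below all their elements, which is excluded; so
    [coinitial_of_finite_choices] applies. *)
Lemma coinitial_of_meeting (b : I -> HR) (L : set HR) : downward_directed J ->
  (forall k, J k -> H_below k (b k) /\ ~ L (b k)) ->
  (forall (S : I -> seq I) (s : seq I) z,
     (forall k, J k -> H [set` S k] (H_val (b k))) -> J z ->
     (forall k, k \in s -> J k) ->
     (forall k i, k \in s -> i \in S k -> (z <= i)%O) ->
     (forall x : X, exists2 k, k \in s & ~ meeting (S k) x) -> L (b z)) ->
  has_coinitial_chain J.
Proof.
move=> dirJ hb hL.
have [k|S hS] := @choice I (seq I) (fun k s => J k ->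
    (forall i, i \in s -> J i /\ (i <= k)%O) /\ H [set` s] (H_val (b k))).
  have [Jk|] := pselect (J k); last by exists [::].
  have [s [sk hs]] := H_finite_levels (hb k Jk).1.
  by exists s => _; split=> //; exact: hs.
have [J0 _] := dirJ.
apply: (coinitial_of_finite_choices (S := S)) J0 _ _ => [k /hS[]//|s sJ].
apply: contrapT => nA.
have [i /flatten_mapP[k ks iS]|z Jz hz] :=
    directed_lower_bound (s := flatten [seq S k | k <- s]) dirJ.
  by have [/(_ i iS)[]] := hS k (sJ k ks).
apply: (hb z Jz).2; apply: (hL S s) => // [k /hS[]//|k i ks iS|x].
  by apply: hz; apply/flatten_mapP; exists k.
apply: contrapT => /forall2NP h; apply: nA; exists x.2 => k ks.
by have [|/contrapT] := h k.
Qed.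

Lemma left_primitive_coinitial : left_primitive HR -> has_coinitial_chain J.
Proof.
move=> prim; have dirJ := prime_directed (left_primitive_prime prim).
have [k Jk|b [L [LD LM hb]]] :=
    left_primitive_annihilator (A := H_below) (J := J) prim.
  split; [exact: H_below0| |exact: H_belowM|exact: H_below_neq0].
  by move=> a c; exact: H_add.
apply: (coinitial_of_meeting (b := b) (L := L) dirJ).
  by move=> k /hb[].
move=> S s z bS Jz sJ sz hx.
apply: (left_ideal_meeting bS LD _ Jz LM sJ sz) => [k /hb[]//| |x y _].
  by have [] := hb z Jz.
exact: hx.
Qed.

Lemma right_primitive_coinitial : right_primitive HR -> has_coinitial_chain J.
Proof.
move=> prim.
have dirJ := prime_directed (prime_converse (left_primitive_prime prim)).
have [k Jk|b [L [LD LM hb]]] :=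
    (* Over the converse ring the left ideal [L] becomes a right ideal of [HR]. *)
    @left_primitive_annihilator HR^c _ J H_below prim.
  split; [exact: H_below0| | |exact: H_below_neq0].
    by move=> a c; exact: H_add.
  by move=> r a /(H_belowM r)[].
apply: (coinitial_of_meeting (b := b) (L := L) dirJ).
  by move=> k /hb[].
move=> S s z bS Jz sJ sz hx.
apply: (right_ideal_meeting bS LD _ Jz LM sJ sz) => [k /hb[]//| |x y _].
  by have [] := hb z Jz.
exact: hx.
Qed.
End Primitive.
End Lemmas.

Theorem theorem6p4 (da : Order.disp_t) (aleph : bOrderType da)
    (aleph_card : infinite_initial_ordinal aleph) (K : fieldType)
    (d : Order.disp_t) (I : porderType d) (I_neq0 : [set: I] !=set0)
    (I_aleph : aleph_poset aleph I) (I_cofinal : has_finite_cofinal I)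
    (J : set I) (J_upper : upper_subset J) :
  (prime_ring (H_ring aleph K I_cofinal J_upper) <-> downward_directed J) /\
  ((right_primitive (H_ring aleph K I_cofinal J_upper) <->
      has_coinitial_chain J) /\
   (has_coinitial_chain J <->
      left_primitive (H_ring aleph K I_cofinal J_upper))).
Proof.
have [inf _ _] := aleph_card.
split; [|split]; split.
- exact: prime_directed.
(* When [J] is a single maximal element, only scalars are available and the ring is treated apart;
   otherwise some level of [J] has matrix units. *)
- move=> dirJ; have [[z mz Jz]|[n Jn nn]] := directed_nonmaximal dirJ.
    exact/left_primitive_prime/(H_maximal_left_primitive _ _ _ _ mz Jz).
  exact (directed_prime K I_cofinal J_upper inf Jn nn dirJ).
- exact: right_primitive_coinitial.
- move=> cJ; have dirJ := coinitial_chain_directed cJ.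
  have [[z mz Jz]|[n Jn nn]] := directed_nonmaximal dirJ.
    exact: H_maximal_right_primitive mz Jz.
  have [C [C0 CJ totC cofC]] := cJ.
  exact (coinitial_right_primitive
    K I_cofinal J_upper inf Jn nn C0 CJ totC cofC).
- move=> cJ; have dirJ := coinitial_chain_directed cJ.
  have [[z mz Jz]|[n Jn nn]] := directed_nonmaximal dirJ.
    exact: H_maximal_left_primitive mz Jz.
  have [C [C0 CJ totC cofC]] := cJ.
  exact (coinitial_left_primitive
    K I_cofinal J_upper inf Jn nn C0 CJ totC cofC).
- exact: left_primitive_coinitial.
Qed.
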